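(* Let $p$ be an odd prime and $n\ge0$. The $\mathbb Z_p[\Gamma_n]$-module $T_\Delta\log_p U_n$ is generated by $T_\Delta\widetilde{\mathscr T}_n$ and $p$, where $\widetilde{\mathscr T}_n=\sum_{i=1}^n p^{i-n}\zeta_{p^{i+1}}$; i.e. $T_\Delta\log_pU_n=\mathbb Z_p[\Gamma_n]T_\Delta\widetilde{\mathscr T}_n+\mathbb Z_p[\Gamma_n]\,p$.
   Context: Fix a primitive $p^{n+1}$-th root of unity $\zeta_{p^{n+1}}\in\overline{\mathbb{Q}}_p$, $\zeta_{p^{i+1}}=\zeta_{p^{n+1}}^{p^{n-i}}$. $K=\mathbb{Q}_p(\zeta_{p^{n+1}})$, $\mathcal O_n$ its ring of integers, $U_n=1+(\zeta_{p^{n+1}}-1)\mathcal O_n$. Identify $\mathrm{Gal}(K/\mathbb{Q}_p)$ with $(\mathbb Z/p^{n+1})^\times$ via $\sigma_a(\zeta_{p^{n+1}})=\zeta_{p^{n+1}}^a$; $\Delta=\{\sigma_a:a^{p-1}\equiv1\bmod p^{n+1}\}\cong(\mathbb Z/p)^\times$, $\Gamma_n=\mathrm{Gal}(K/\mathbb{Q}_p(\zeta_p))$. $T_\Delta=\sum_{\delta\in\Delta}\delta$, acting on $K$. $\log_p$ is the $p$-adic logarithm and $T_\Delta\log_pU_n=\{T_\Delta\log_p u:u\in U_n\}$. *)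

(* Defs.v *)
From HB Require Import structures.
From mathcomp Require Import all_boot all_order all_algebra all_fingroup all_field.
From mathcomp Require Import boolp classical_sets.

Set Implicit Arguments.
Unset Strict Implicit.
Unset Printing Implicit Defensive.

Import GRing.Theory.

Local Open Scope ring_scope.

Definition pred_mod p k (a : 'Z_(p ^ k.+2)) : 'Z_(p ^ k.+1) := (val a)%:R.

(* The ring Z_p of p-adic integers, as the inverse limit of the rings
   Z/p^(k+1), k >= 0. The component of index k lives modulo p^(k+1), and not
   p^k, so that 'Z_(p ^ k.+1) is genuinely Z/p^(k+1) ('Z_1 is not). *)
Record padic_int (p : nat) (p_pr : prime p) : Type := PadicInt {
  pcomp :> forall k : nat, 'Z_(p ^ k.+1);
  pcompP : forall k : nat, pcomp k = pred_mod (pcomp k.+1)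
}.

Section PadicInt.
Variables (p : nat) (p_pr : prime p).

Local Notation Zp := (padic_int p_pr).

HB.instance Definition _ := gen_eqMixin Zp.
HB.instance Definition _ := gen_choiceMixin Zp.

Implicit Types x y z : Zp.

Lemma padic_int_inj x y : (forall k, x k = y k) -> x = y.
Proof.
case: x => f fP; case: y => g gP /= fg.
have fgE : f = g by apply: functional_extensionality_dep.
by case: _ / fgE gP fg => gP _; congr PadicInt; exact: Prop_irrelevance.
Qed.

Lemma expp_gt1 k : (1 < p ^ k.+1)%N.
Proof. by rewrite -{1}(exp1n k.+1) ltn_exp2r // prime_gt1. Qed.

Lemma pred_mod_natr k (n : nat) :
  pred_mod (n%:R : 'Z_(p ^ k.+2)) = n%:R.
Proof.
rewrite /pred_mod; apply: val_inj; rewrite /= !val_Zp_nat ?expp_gt1 //.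
by rewrite modn_dvdm // dvdn_exp2l.
Qed.

Lemma pred_modD k (a b : 'Z_(p ^ k.+2)) :
  pred_mod (a + b) = pred_mod a + pred_mod b.
Proof. by rewrite -(natr_Zp a) -(natr_Zp b) -natrD !pred_mod_natr natrD. Qed.

Lemma pred_modM k (a b : 'Z_(p ^ k.+2)) :
  pred_mod (a * b) = pred_mod a * pred_mod b.
Proof. by rewrite -(natr_Zp a) -(natr_Zp b) -natrM !pred_mod_natr natrM. Qed.

Lemma pred_mod0 k : pred_mod (0 : 'Z_(p ^ k.+2)) = 0.
Proof. exact: (pred_mod_natr k 0). Qed.

Lemma pred_mod1 k : pred_mod (1 : 'Z_(p ^ k.+2)) = 1.
Proof. exact: (pred_mod_natr k 1). Qed.

Lemma pred_modN k (a : 'Z_(p ^ k.+2)) : pred_mod (- a) = - pred_mod a.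
Proof. by apply/eqP; rewrite -subr_eq0 opprK -pred_modD addNr pred_mod0. Qed.

Definition padic_zero := @PadicInt p p_pr (fun=> 0) (fun k => esym (pred_mod0 k)).
Definition padic_one := @PadicInt p p_pr (fun=> 1) (fun k => esym (pred_mod1 k)).

Fact padic_opp_subproof x k : - x k = pred_mod (- x k.+1).
Proof. by rewrite pred_modN -pcompP. Qed.
Definition padic_opp x := PadicInt p_pr (padic_opp_subproof x).

Fact padic_add_subproof x y k : x k + y k = pred_mod (x k.+1 + y k.+1).
Proof. by rewrite pred_modD -!pcompP. Qed.
Definition padic_add x y := PadicInt p_pr (padic_add_subproof x y).

Fact padic_mul_subproof x y k : x k * y k = pred_mod (x k.+1 * y k.+1).
Proof. by rewrite pred_modM -!pcompP. Qed.
Definition padic_mul x y := PadicInt p_pr (padic_mul_subproof x y).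

Fact padic_addA : associative padic_add.
Proof. by move=> x y z; apply: padic_int_inj => k; apply: addrA. Qed.
Fact padic_addC : commutative padic_add.
Proof. by move=> x y; apply: padic_int_inj => k; apply: addrC. Qed.
Fact padic_add0 : left_id padic_zero padic_add.
Proof. by move=> x; apply: padic_int_inj => k; apply: add0r. Qed.
Fact padic_addN : left_inverse padic_zero padic_opp padic_add.
Proof. by move=> x; apply: padic_int_inj => k; apply: addNr. Qed.

HB.instance Definition _ :=
  GRing.isZmodule.Build Zp padic_addA padic_addC padic_add0 padic_addN.

Fact padic_mulA : associative padic_mul.
Proof. by move=> x y z; apply: padic_int_inj => k; apply: mulrA. Qed.
Fact padic_mulC : commutative padic_mul.
Proof. by move=> x y; apply: padic_int_inj => k; apply: mulrC. Qed.
Fact padic_mul1 : left_id padic_one padic_mul.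
Proof. by move=> x; apply: padic_int_inj => k; apply: mul1r. Qed.
Fact padic_mulDl : left_distributive padic_mul padic_add.
Proof. by move=> x y z; apply: padic_int_inj => k; apply: mulrDl. Qed.
Fact padic_one_neq0 : padic_one != padic_zero.
Proof. by apply/eqP => /(congr1 (fun x : Zp => x 0%N))/eqP; rewrite oner_eq0. Qed.

HB.instance Definition _ := GRing.Zmodule_isComNzRing.Build Zp
  padic_mulA padic_mulC padic_mul1 padic_mulDl padic_one_neq0.

Definition padic_unit : pred Zp := fun x => `[< exists y, y * x = 1 >].
Definition padic_inv x : Zp := xget x [set y | y * x = 1].

Fact padic_mulVx : {in padic_unit, left_inverse 1 padic_inv *%R}.
Proof. by move=> x /asboolP[y yx]; rewrite /padic_inv; case: xgetP => // /(_ y). Qed.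
Fact padic_unitPl x y : y * x = 1 -> padic_unit x.
Proof. by move=> yx; apply/asboolP; exists y. Qed.
Fact padic_inv_out : {in [predC padic_unit], padic_inv =1 id}.
Proof.
move=> x /asboolP nx; rewrite /padic_inv; case: xgetP => // y _ yx.
by case: nx; exists y.
Qed.

HB.instance Definition _ := GRing.ComNzRing_hasMulInverse.Build Zp
  padic_mulVx padic_unitPl padic_inv_out.

Lemma pcomp_le x k d : (x (d + k)%N : nat) = x k %[mod p ^ k.+1].
Proof.
elim: d => [//|d <-]; rewrite (pcompP x (d + k)) /pred_mod val_Zp_nat ?expp_gt1 //.
by rewrite modn_dvdm // dvdn_exp2l // ltnS leq_addl.
Qed.

Lemma pcomp_neq0 x k d : x k != 0 -> ~~ (p ^ k.+1 %| x (d + k)%N)%N.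
Proof.
apply: contra => /eqP; rewrite pcomp_le => xk0; apply/eqP.
by apply: val_inj; rewrite -(natr_Zp (x k)) /= val_Zp_nat ?expp_gt1.
Qed.

Fact padic_integral : GRing.integral_domain_axiom Zp.
Proof.
move=> x y xy0; apply/norP => -[/eqP x0 /eqP y0].
have nz z : z <> 0 -> exists k, z k != 0.
  move=> z0; apply: contrapT => /forallNP zk; apply: z0.
  by apply: padic_int_inj => k; have /negP := zk k; rewrite negbK => /eqP.
have [i xi] := nz _ x0; have [j yj] := nz _ y0.
have /(congr1 (@nat_of_ord _)) : x (i + j)%N * y (i + j)%N = 0.
  exact: (congr1 (fun z : Zp => z (i + j)%N) xy0).
rewrite -[x _]natr_Zp -[y _]natr_Zp -natrM val_Zp_nat ?expp_gt1 // => /eqP xyd.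
have xn := pcomp_neq0 j xi; have yn := pcomp_neq0 i yj.
have gt0 (m k : nat) : ~~ (p ^ k %| m)%N -> (0 < m)%N by case: m; rewrite ?dvdn0.
move: xyd xn yn; rewrite (addnC j i) -/(dvdn _ _).
set a := nat_of_ord (x _); set b := nat_of_ord (y _) => xyd xn yn.
have [a0 b0] := (gt0 _ _ xn, gt0 _ _ yn); move: xyd xn yn.
rewrite !pfactor_dvdn ?muln_gt0 ?a0 // lognM // -!ltnNge !ltnS => h ha hb.
by have := leq_ltn_trans (leq_add ha hb) h; rewrite ltnn.
Qed.

HB.instance Definition _ :=
  GRing.ComUnitRing_isIntegral.Build Zp padic_integral.

End PadicInt.

Notation padic_field p_pr := {fraction padic_int p_pr}.

Section PadicExtension.
Variables (p : nat) (p_pr : prime p) (K : fieldExtType (padic_field p_pr)).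

Local Open Scope classical_set_scope.

Implicit Types (x l u : K) (s : nat -> K).

Definition Zp_to_ext (a : padic_int p_pr) : K := (FracField.tofrac a)%:A.

Definition integers : set K := [set x | integralOver Zp_to_ext x].

(* Convergence for the p-adic topology of K, in which the sets p^N O_K form a
   basis of neighbourhoods of 0. *)
Definition padic_cvg s l :=
  forall N : nat, exists M : nat, forall m : nat, (M <= m)%N ->
    exists2 x, integers x & s m - l = p%:R ^+ N * x.

Definition log_partial_sum u (m : nat) : K :=
  \sum_(1 <= k < m.+1) (-1) ^+ k.+1 * (u - 1) ^+ k / k%:R.

(* The value 0 taken where the series diverges is a dummy one. *)
Definition padic_log u : K := xget 0 [set l | padic_cvg (log_partial_sum u) l].

End PadicExtension.

(* K is meant to be Q_p(zeta), with zeta a primitive p^(n+1)-th root of unity.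
   It is a splittingFieldType only in order to have the library's Galois
   groups: Q_p(zeta) is always a splitting field over Q_p. *)
Section Cyclotomic.
Variables (p : nat) (p_pr : prime p) (K : splittingFieldType (padic_field p_pr)).
Variables (n : nat) (zeta : K).

Local Notation galK := (gal_of {:K}).

(* The root of unity zeta_{p^(i+1)}, for i <= n. *)
Definition zeta_ (i : nat) : K := zeta ^+ (p ^ (n - i)).

(* The sigma_a : zeta -> zeta^a such that a^(p-1) = 1 modulo p^(n+1). *)
Definition Delta : {set galK} :=
  [set s in 'Gal({:K} / 1)%g | [exists a : 'I_(p ^ n.+1),
     (s zeta == zeta ^+ a) && (a ^ (p - 1) == 1 %[mod p ^ n.+1])]].

Definition Gamma : {set galK} := 'Gal({:K} / <<1; zeta_ 0>>)%g.

Definition T_Delta (x : K) : K := \sum_(d in Delta) (d : galK) x.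

Definition Ttilde : K := \sum_(1 <= i < n.+1) p%:R ^- (n - i) * zeta_ i.

(* The action on K of the element \sum_(g in Gamma) (a g) g of Z_p[Gamma];
   the values of a outside Gamma are irrelevant. *)
Definition group_ring_act (a : galK -> padic_int p_pr) (x : K) : K :=
  \sum_(g in Gamma) FracField.tofrac (a g) *: (g : galK) x.

Local Open Scope classical_set_scope.

Definition units1 : set K :=
  [set 1 + (zeta - 1) * x | x in @integers p p_pr K].

Definition cyclic_module (x : K) : set K :=
  [set group_ring_act a x | a in [set: galK -> padic_int p_pr]].

End Cyclotomic.

(* Main.v *)
(* Write T = T_Delta, and gamma for the automorphism zeta -> zeta^(1+p), which
   generates Gamma. For f in Z_p[X] with f(1) = 1, Dwork's congruence f^p =
   f(X^p) mod p makes (1 - phi/p) log f an integral g modulo X^(p^(n+1)) - 1, so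
   that log f(zeta) is the sum of the p^-j g(zeta^(p^j)) for j <= n; logarithms
   are handled as the limits of (u^(p^m) - 1) / p^m. Every principal unit is
   such an f(zeta), because the ring of integers is Z_p[zeta], and applying T to
   the sum attached to a single power X^a yields - p^-n plus an element of the
   module M on the right-hand side. As g(1) = 0 the terms - p^-n cancel, which
   gives the inclusion in M.

   Conversely, the image of T log is a complete Gamma-stable subgroup of M, so
   that it is enough to generate M modulo p. The unit 1 + p provides p, and f =
   1 - p + Phi_p provides P(gamma) T Ttilde, where the augmentation P(1) is read
   off from f(zeta_0) = 1 - p and is a unit; since P(gamma) is then invertible
   modulo p, T Ttilde is obtained as well. *)

(* The hypotheses provide neither the degree of K nor the automorphisms sigma_a. Both are extracted
   from ramification: with pi = zeta - 1, p is pi^(phi(p^(n+1))) times a unit of Z_p[zeta]. The same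
   fact shows that Z_p[zeta] is closed under exact division by p, hence is the full ring of
   integers. No valuation appears: every estimate is a membership in p^N O_K with an explicit
   cofactor. Where possible the cofactor is a polynomial over Z_p, so that one identity serves at
   all p^(n+1)-th roots of unity at once, in particular at zeta, zeta_0 and 1. The limit of (u^(p^m)
   - 1) / p^m is preferred to the series because multiplicativity, Galois equivariance and
   congruences modulo p^k are visible at each finite m; the series is compared with it only once. In
   the converse, approximation modulo p lifts to equality because p^k log u = log u^(p^k): the
   corrections multiply up to an infinite product of the u_k^(p^k), which converges since the
   p^(n+1)-th power of a principal unit is 1 modulo p. *)
From HB Require Import structures.
Require Import Defs.
From mathcomp Require Import all_boot all_order all_algebra all_fingroup all_solvable all_field.
From mathcomp Require Import boolp classical_sets.
From mathcomp Require Import ring zify.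

Set Implicit Arguments.
Unset Strict Implicit.
Unset Printing Implicit Defensive.

Import GRing.Theory.

Local Open Scope ring_scope.

(** * Divisibility, units and completeness of Z_p *)

Section PadicIntegers.
Variables (p : nat) (p_pr : prime p).
Local Notation Zp := (padic_int p_pr).
Implicit Types x y : Zp.

Lemma pcompD x y k : (x + y) k = x k + y k. Proof. by []. Qed.
Lemma pcompM x y k : (x * y) k = x k * y k. Proof. by []. Qed.
Lemma pcompN x k : (- x) k = - x k. Proof. by []. Qed.
Lemma pcomp_nat (m : nat) k : (m%:R : Zp) k = m%:R.
Proof. by elim: m => [//|m IHm]; rewrite -!natr1 pcompD IHm. Qed.

(* x = p^(k+1) y with y_j = x_(j+k+1) / p^(k+1). *)
Lemma pcomp_eq0 x k : x k = 0 -> exists y, x = p%:R ^+ k.+1 * y.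
Proof.
move=> xk0.
have pk_gt0 : (0 < p ^ k.+1)%N by rewrite expn_gt0 prime_gt0.
have xdvd j : (p ^ k.+1 %| x (j + k.+1)%N)%N.
  rewrite /dvdn addnS; have := pcomp_le x k j.+1; rewrite addSn xk0 mod0n.
  by move=> ->.
pose f j : 'Z_(p ^ j.+1) := (x (j + k.+1)%N %/ p ^ k.+1)%:R.
have fP j : f j = pred_mod (f j.+1).
  rewrite /f pred_mod_natr //.
  have := pcomp_le x (j + k.+1) 1; move: (xdvd j) (xdvd j.+1); rewrite add1n addSn.
  move: (nat_of_ord (x _)) (nat_of_ord (x _)) => _ _ /dvdnP[a ->] /dvdnP[b ->].
  rewrite !mulnK // -addSn expnD -!muln_modl => /eqP.
  rewrite eqn_pmul2r // => /eqP ba.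
  by apply: val_inj; rewrite /= !val_Zp_nat ?expp_gt1 // ba.
exists (PadicInt p_pr fP); apply: padic_int_inj => j.
have -> : x j = (x (j + k.+1)%N : nat)%:R.
  apply: val_inj; rewrite /= val_Zp_nat ?expp_gt1 // addnC pcomp_le modn_small //.
  by rewrite -[X in (_ < X)%N](Zp_cast (expp_gt1 p_pr j)) ltn_ord.
by rewrite pcompM -natrX pcomp_nat /= /f -natrM mulnC divnK.
Qed.

Lemma pcomp_approx x k : exists y, x = (x k : nat)%:R + p%:R ^+ k.+1 * y.
Proof.
have [|y xy] := @pcomp_eq0 (x - (x k : nat)%:R) k.
  by rewrite pcompD pcompN pcomp_nat natr_Zp subrr.
by exists y; rewrite -xy addrC subrK.
Qed.

Lemma padic_digit x : exists (r : nat) y, x = r%:R + p%:R * y.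
Proof. by have [y ->] := pcomp_approx x 0; exists (x 0%N : nat), y. Qed.

Lemma pcomp0_p x : (p%:R * x) 0%N = 0.
Proof.
rewrite pcompM pcomp_nat.
suff -> : (p%:R : 'Z_(p ^ 1)) = 0 by rewrite mul0r.
by apply: val_inj; rewrite /= val_Zp_nat ?expp_gt1 // expn1 modnn.
Qed.

Lemma padic_unitP x : (x \is a GRing.unit) = (x 0%N != 0).
Proof.
apply/idP/idP => [ux|x0].
  apply: contraTneq ux => x0; have [y ->] := pcomp_eq0 x0.
  rewrite expr1; apply/negP => ux.
  have /(congr1 (fun x : Zp => x 0%N)) := divrr ux.
  by rewrite -mulrA pcomp0_p => /eqP; rewrite eq_sym oner_eq0.
have xU k : x k \is a GRing.unit.
  rewrite -(natr_Zp (x k)) unitZpE ?expp_gt1 // coprime_pexpl //.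
  rewrite prime_coprime //; have := pcomp_neq0 k x0.
  by rewrite addn0 expn1.
have yP k : (x k)^-1 = pred_mod (x k.+1)^-1.
  apply: (mulrI (xU k)); rewrite (divrr (xU k)) [X in X * _](pcompP x k).
  by rewrite -(pred_modM p_pr) (divrr (xU _)) (pred_mod1 p_pr).
apply/unitrPr; exists (PadicInt p_pr yP); apply: padic_int_inj => k.
by rewrite pcompM /= (divrr (xU _)).
Qed.

Lemma padic_nat_unit (m : nat) : ((m%:R : Zp) \is a GRing.unit) = ~~ (p %| m)%N.
Proof.
rewrite padic_unitP pcomp_nat; congr (~~ _); apply/eqP/idP => [/(congr1 val)|].
  by rewrite /= val_Zp_nat ?expp_gt1 // expn1 => /eqP.
move=> pm; apply: val_inj; rewrite /= val_Zp_nat ?expp_gt1 // expn1.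
exact/eqP.
Qed.

Lemma padic_dvd_or_unit x : x \is a GRing.unit \/ exists y, x = p%:R * y.
Proof.
rewrite padic_unitP; case: eqP => [/pcomp_eq0[y ->]|_]; [right|by left].
by exists y.
Qed.

Lemma padic_unitDp x y : (x + p%:R * y \is a GRing.unit) = (x \is a GRing.unit).
Proof. by rewrite !padic_unitP pcompD pcomp0_p addr0. Qed.

Lemma padic_unit_dvd (x : Zp) : ~~ (p%:R * x \is a GRing.unit).
Proof. by rewrite padic_unitP pcomp0_p eqxx. Qed.

Lemma padic_p_neq0 : (p%:R : Zp) != 0.
Proof.
apply/eqP => /(congr1 (fun x : Zp => val (x 1%N))).
rewrite pcomp_nat /= val_Zp_nat ?expp_gt1 // modn_small; last first.
  by rewrite -{1}(expn1 p) ltn_exp2l // prime_gt1.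
by move=> p0; have := prime_gt0 p_pr; rewrite p0.
Qed.

Lemma padic_factor x : x != 0 ->
  exists k y, y \is a GRing.unit /\ x = p%:R ^+ k * y.
Proof.
move=> x0; have [k xk] : exists k, x k != 0.
  apply: contrapT => /forallNP xk; case/eqP: x0.
  by apply: padic_int_inj => k; have /negP := xk k; rewrite negbK => /eqP.
elim: k x xk {x0} => [|k IHk] x xk.
  by exists 0%N, x; rewrite mul1r padic_unitP.
case: (padic_dvd_or_unit x) => [ux|[y xy]]; first by exists 0%N, x; rewrite mul1r.
have [|j [z [uz yz]]] := IHk y.
  apply: contraNneq xk => /pcomp_eq0[z yz]; rewrite xy yz mulrA -exprS.
  rewrite pcompM -natrX pcomp_nat.
  suff -> : ((p ^ k.+2)%:R : 'Z_(p ^ k.+2)) = 0 by rewrite mul0r.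
  by apply: val_inj; rewrite /= val_Zp_nat ?expp_gt1 // modnn.
by exists j.+1, z; split => //; rewrite xy yz mulrA -exprS.
Qed.

(** Completeness of Z_p: the terms of index greater than k vanish modulo p^(k+1), so component k of
    the sum is read off from the first k+1 terms. *)
Lemma padic_series (c : nat -> Zp) :
  exists s, forall N, exists y, s = \sum_(m < N) p%:R ^+ m * c m + p%:R ^+ N * y.
Proof.
pose S N := \sum_(m < N) p%:R ^+ m * c m.
have fP k : S k.+1 k = pred_mod (S k.+2 k.+1).
  rewrite -pcompP [in RHS]/S big_ord_recr pcompD pcompM -natrX pcomp_nat.
  suff -> : ((p ^ k.+1)%:R : 'Z_(p ^ k.+1)) = 0 by rewrite mul0r addr0.
  by apply: val_inj; rewrite /= val_Zp_nat ?expp_gt1 // modnn.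
exists (PadicInt p_pr fP) => -[|N]; first by eexists; rewrite big_ord0 add0r mul1r.
have [|y sy] := @pcomp_eq0 (PadicInt p_pr fP - S N.+1) N.
  by rewrite pcompD pcompN subrr.
by exists y; rewrite -sy addrC subrK.
Qed.

End PadicIntegers.

(** * The ring of integers of K and the neighbourhoods p^N O_K *)

Section Integers.
Variables (p : nat) (p_pr : prime p) (K : splittingFieldType (padic_field p_pr)).
Local Notation Zp := (padic_int p_pr).
Local Notation iota := (@Zp_to_ext p p_pr K).
Implicit Types (x y z : K) (f g : {poly Zp}).

Fact Zp_to_ext_zmod_morphism : zmod_morphism iota.
Proof. by move=> a b; rewrite /Zp_to_ext tofracB scalerBl. Qed.
Fact Zp_to_ext_monoid_morphism : monoid_morphism iota.
Proof.
split=> [|a b]; first by rewrite /Zp_to_ext tofrac1 scale1r.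
by rewrite /Zp_to_ext tofracM -scalerAl mul1r scalerA.
Qed.
HB.instance Definition _ :=
  GRing.isZmodMorphism.Build Zp K iota Zp_to_ext_zmod_morphism.
HB.instance Definition _ :=
  GRing.isMonoidMorphism.Build Zp K iota Zp_to_ext_monoid_morphism.

Lemma Zp_to_ext_inj : injective iota.
Proof.
move=> a b /eqP; rewrite -subr_eq0 -rmorphB /Zp_to_ext scaler_eq0 oner_eq0 orbF.
by rewrite tofrac_eq0 subr_eq0 => /eqP.
Qed.

Lemma Zp_to_ext_unit (a : Zp) : a \is a GRing.unit -> iota a != 0.
Proof. by move=> ua; rewrite -unitfE rmorph_unit. Qed.

Definition Oint : {pred K} := fun x => `[< integers x >].

Lemma OintP x : reflect (integers x) (x \in Oint).
Proof. exact: asboolP. Qed.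

Fact Oint_subring : subring_closed Oint.
Proof.
split=> [|x y /OintP Ox /OintP Oy|x y /OintP Ox /OintP Oy]; apply/OintP.
- exact: integral1.
- exact: integral_sub.
- exact: integral_mul.
Qed.
HB.instance Definition _ := GRing.isSubringClosed.Build K Oint Oint_subring.

Lemma Oint_iota (a : Zp) : iota a \in Oint.
Proof. apply/OintP; exact: integral_id. Qed.

Lemma natK_neq0 (m : nat) : (0 < m)%N -> (m%:R : K) != 0.
Proof.
move=> m0; rewrite -(rmorph_nat iota) -(rmorph0 iota) (inj_eq Zp_to_ext_inj).
apply/eqP => /(congr1 (fun x : Zp => val (x m))).
rewrite pcomp_nat /= val_Zp_nat ?expp_gt1 // modn_small; first by case: m m0.
by apply: (leq_trans (ltn_expl m (prime_gt1 p_pr))); rewrite leq_exp2l ?prime_gt1.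
Qed.

Lemma pK_neq0 : (p%:R : K) != 0. Proof. exact/natK_neq0/prime_gt0. Qed.
Hint Resolve pK_neq0 : core.

(** Multiplying a monic equation of degree s for 1/p by p^s leaves 1 plus a multiple of p equal to 0
    in Z_p, although p is not a unit there. *)
Lemma pinv_notin_Oint : p%:R^-1 \notin Oint.
Proof.
apply/negP => /OintP[f f_monic /eqP f0].
have coef_iota i : (map_poly iota f)`_i = iota f`_i by rewrite coef_map.
have szf : size f = (size f).-1.+1 by rewrite polySpred ?monic_neq0.
set s := (size f).-1 in szf.
have : (p%:R : K) ^+ s * (map_poly iota f).[p%:R^-1] = 0 by rewrite f0 mulr0.
rewrite horner_coef size_map_inj_poly ?rmorph0 //; last exact: Zp_to_ext_inj.
rewrite szf big_ord_recr /= mulrDr mulrCA -exprMn divff // expr1n mulr1 coef_iota.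
have -> : f`_s = 1 by move/monicP: f_monic; rewrite lead_coefE.
rewrite rmorph1 mulr_sumr.
rewrite (eq_bigr (fun i : 'I_s => iota (p%:R * (f`_i * p%:R ^+ (s - i.+1))))).
  rewrite -rmorph_sum -mulr_sumr -(rmorph1 iota) -rmorphD -(rmorph0 iota).
  move=> /Zp_to_ext_inj/eqP; rewrite addr_eq0 => /eqP /(congr1 (fun a => - a)).
  rewrite opprK -mulrN => e; have := padic_unit_dvd (- \sum_(i < s) f`_i * p%:R ^+ (s - i.+1)).
  by rewrite e unitr1.
move=> i _; rewrite coef_iota !rmorphM rmorphXn rmorph_nat mulrCA [RHS]mulrCA.
rewrite -exprS subnSK //; congr (_ * _).
by rewrite exprVn -expfB.
Qed.

Definition Opow N : {pred K} := fun x => p%:R ^- N * x \in Oint.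

Lemma OpowE N x : (x \in Opow N) = (p%:R ^- N * x \in Oint). Proof. by []. Qed.

Fact Opow_zmod N : zmod_closed (Opow N).
Proof.
split=> [|x y]; rewrite !OpowE ?mulr0 ?rpred0 // => Ox Oy.
by rewrite mulrBr rpredB.
Qed.
HB.instance Definition _ N := GRing.isZmodClosed.Build K (Opow N) (Opow_zmod N).

Lemma OpowP N x : reflect (exists2 y, y \in Oint & x = p%:R ^+ N * y) (x \in Opow N).
Proof.
apply: (iffP idP) => [Ox | [y Oy ->]]; last first.
  by rewrite OpowE mulKf ?expf_neq0.
by exists (p%:R ^- N * x) => //; rewrite mulVKf ?expf_neq0.
Qed.

Lemma Opow_p N x : (p%:R ^+ N * x \in Opow N) = (x \in Oint).
Proof. by rewrite OpowE mulKf ?expf_neq0. Qed.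

Lemma Opow0 x : (x \in Opow 0) = (x \in Oint).
Proof. by rewrite OpowE expr0 invr1 mul1r. Qed.

Lemma OpowM M N x y : x \in Opow M -> y \in Opow N -> x * y \in Opow (M + N).
Proof.
move=> /OpowP[a Oa ->] /OpowP[b Ob ->].
by rewrite mulrACA -exprD Opow_p rpredM.
Qed.

Lemma OpowMl N x y : x \in Oint -> y \in Opow N -> x * y \in Opow N.
Proof. by rewrite -Opow0 => Ox Oy; have := OpowM Ox Oy. Qed.

Lemma OpowW M N x : (M <= N)%N -> x \in Opow N -> x \in Opow M.
Proof.
move=> /subnK MN /OpowP[y Oy ->]; rewrite -MN addnC exprD -mulrA Opow_p.
by rewrite rpredM ?rpredX ?rpred_nat.
Qed.

Lemma Opow_mulp N x : (p%:R * x \in Opow N.+1) = (x \in Opow N).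
Proof. by rewrite !OpowE exprS invfM mulrACA mulVf // mul1r. Qed.

Lemma Opow_mulpX M N x : (p%:R ^+ M * x \in Opow (M + N)) = (x \in Opow N).
Proof.
by elim: M => [|M IHM]; rewrite ?mul1r // exprS addSn -mulrA Opow_mulp.
Qed.

Lemma padic_cvgP s l : padic_cvg s l <->
  forall N, exists M, forall m, (M <= m)%N -> s m - l \in Opow N.
Proof.
split=> sl N; have [M sM] := sl N; exists M => m /sM.
  by case=> x /OintP Ox ->; rewrite Opow_p.
by move=> /OpowP[x /OintP Ox ->]; exists x.
Qed.

Definition peval z f : K := (map_poly iota f).[z].
Fact peval_zmod_morphism z : zmod_morphism (peval z).
Proof. by move=> f g; rewrite /peval rmorphB hornerD hornerN. Qed.
Fact peval_monoid_morphism z : monoid_morphism (peval z).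
Proof. by split=> [|f g]; rewrite /peval ?rmorph1 ?rmorphM ?hornerC ?hornerM. Qed.
HB.instance Definition _ z :=
  GRing.isZmodMorphism.Build {poly Zp} K (peval z) (peval_zmod_morphism z).
HB.instance Definition _ z :=
  GRing.isMonoidMorphism.Build {poly Zp} K (peval z) (peval_monoid_morphism z).

Lemma pevalC z (a : Zp) : peval z a%:P = iota a.
Proof. by rewrite /peval map_polyC hornerC. Qed.
Lemma pevalX z : peval z 'X = z.
Proof. by rewrite /peval map_polyX hornerX. Qed.
Lemma pevalZ z (a : Zp) f : peval z (a *: f) = iota a * peval z f.
Proof. by rewrite -mul_polyC rmorphM /= pevalC. Qed.
Lemma peval_iota (a : Zp) f : peval (iota a) f = iota f.[a].
Proof. by rewrite /peval horner_map. Qed.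
Lemma peval_comp z f m : peval z (f \Po 'X^m) = peval (z ^+ m) f.
Proof. by rewrite /peval map_comp_poly horner_comp map_polyXn hornerXn. Qed.
Lemma pevalE z f : peval z f = \sum_(i < size f) iota f`_i * z ^+ i.
Proof.
rewrite /peval horner_coef size_map_inj_poly ?rmorph0 //; last exact: Zp_to_ext_inj.
by apply: eq_bigr => i _; rewrite coef_map.
Qed.

Lemma peval_Oint z f : z \in Oint -> peval z f \in Oint.
Proof.
move=> Oz; rewrite pevalE rpred_sum // => i _.
by rewrite rpredM ?rpredX ?Oint_iota.
Qed.

Lemma unity_Oint m z : (0 < m)%N -> z ^+ m = 1 -> z \in Oint.
Proof.
move=> m0 zm; apply/OintP; exists ('X^m - 1); first by rewrite monicXnsubC.
by rewrite rmorphB rmorph1 /= map_polyXn /root !hornerE zm subrr.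
Qed.

Lemma galK_iota (s : gal_of {:K}) (a : Zp) : s (iota a) = iota a.
Proof. by rewrite /Zp_to_ext linearZ rmorph1. Qed.
Lemma gal_peval (s : gal_of {:K}) z f : s (peval z f) = peval (s z) f.
Proof.
rewrite !pevalE rmorph_sum; apply: eq_bigr => i _.
by rewrite rmorphM rmorphXn /= galK_iota.
Qed.

Lemma gal_Oint (s : gal_of {:K}) x : x \in Oint -> s x \in Oint.
Proof.
move=> /OintP[f f_monic f0]; apply/OintP; exists f => //.
by rewrite /root -[_.[_]]/(peval (s x) f) -gal_peval fmorph_eq0.
Qed.
Lemma gal_Opow N (s : gal_of {:K}) x : x \in Opow N -> s x \in Opow N.
Proof.
by move=> /gal_Oint - /(_ s); rewrite rmorphM fmorphV rmorphXn /= rmorph_nat.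
Qed.

End Integers.

(** * How p-th powers improve congruences modulo powers of p *)

Section FrobeniusLifts.
Variables (p : nat) (p_pr : prime p) (R : comNzRingType).
Implicit Types x y z b h : R.

(** The linear term is kept explicit because the recursions below follow a quotient by p^(m+1) from
    one p-th power to the next. *)
Lemma exprD_prime x h : exists z,
  (x + h) ^+ p = x ^+ p + h ^+ p + p%:R * (x ^+ p.-1 * h + h ^+ 2 * z).
Proof.
move: p_pr; case: p => [|[|q]] // q_pr /=.
exists (\sum_(i < q) (x ^+ (q - i) * h ^+ i *+ ('C(q.+2, i.+2) %/ q.+2))).
rewrite exprDn big_ord_recr big_ord_recl big_ord_recl /=.
rewrite /bump /= !add1n bin0 bin1 subn0 subnn subn1 expr0 expr1 binn mul1r mulr1 !mulr1n /=.
rewrite -!addrA; congr (_ + _); rewrite !addrA [RHS]addrC mulrDr.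
congr (_ + _ + _); first by rewrite mulr_natl.
rewrite !mulr_sumr; apply: eq_bigr => i _; rewrite !add1n !subSS.
rewrite mulr_natl mulrnAr -mulrnA divnK; last by rewrite prime_dvd_bin //= !ltnS ltn_ord.
by congr (_ *+ _); rewrite [RHS]mulrCA -exprD.
Qed.

Lemma exprDn2 x h m : exists z, (x + h) ^+ m = x ^+ m + h * (m%:R * x ^+ m.-1 + h * z).
Proof.
elim: m => [|m [z IHm]]; first by exists 0; rewrite /= mul0r mulr0 addr0 mulr0 addr0.
exists (x * z + (m%:R * x ^+ m.-1 + h * z)).
rewrite exprS IHm; case: m {IHm} => [|m] /=; first by rewrite !expr0 expr1; ring.
by rewrite -(natr1 m.+1) !exprS; ring.
Qed.

Hypothesis p_odd : odd p.

(* For p = 2 the term of degree p would only be divisible by p^(2m+2). *)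
Lemma exprD_lift m b y : exists z,
  (b + p%:R ^+ m.+1 * y) ^+ p = b ^+ p + p%:R ^+ m.+2 * (b ^+ p.-1 * y + p%:R ^+ m.+1 * z).
Proof.
have p_gt2 : (2 < p)%N by rewrite odd_prime_gt2.
set h := p%:R ^+ m.+1 * y; have [z ->] := exprD_prime b h.
exists (y ^+ 2 * z + p%:R ^+ m * y ^+ 3 * h ^+ (p - 3)).
rewrite -{2}(subnKC p_gt2) exprD /h; move: (_ ^+ (p - 3)) (b ^+ p.-1) => u v.
by rewrite !exprS; move: (p%:R ^+ m) => P; ring.
Qed.

Lemma exprD_lift1 m x y : exists z,
  (x + p%:R ^+ m.+1 * y) ^+ p = x ^+ p + p%:R ^+ m.+2 * z.
Proof. by have [z ->] := exprD_lift m x y; eexists. Qed.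

Lemma expr_pX_lift i k x y : exists z,
  (x + p%:R ^+ i.+1 * y) ^+ (p ^ k) = x ^+ (p ^ k) + p%:R ^+ (i + k).+1 * z.
Proof.
elim: k => [|k [z IHk]]; first by exists y; rewrite !expr1 addn0.
by rewrite addnS expnSr !exprM IHk; apply: exprD_lift1.
Qed.

End FrobeniusLifts.

(** * Residues modulo p^(k+1): lifts of residues modulo p, and powers of 1 + p *)

Section NatCongruences.
Variables (p : nat) (p_pr : prime p) (p_odd : odd p).
Local Notation Zp := (padic_int p_pr).

(** Turns congruences between natural numbers into identities in Z_p, where ring computations and
    the lifting lemmas apply. *)
Lemma padic_natmodP k a b :
  a = b %[mod p ^ k.+1] <-> exists z : Zp, a%:R = b%:R + p%:R ^+ k.+1 * z.
Proof.
split=> [ab|[z ab]].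
  have [|z ez] := @pcomp_eq0 p p_pr (a%:R - b%:R) k.
    rewrite pcompD pcompN !pcomp_nat; apply/eqP; rewrite subr_eq0; apply/eqP.
    by apply: val_inj; rewrite /= !val_Zp_nat ?expp_gt1.
  by exists z; rewrite -ez addrC subrK.
have := congr1 (fun x : Zp => x k) ab; rewrite pcompD pcompM -natrX !pcomp_nat.
have -> : ((p ^ k.+1)%:R : 'Z_(p ^ k.+1)) = 0.
  by apply: val_inj; rewrite /= val_Zp_nat ?expp_gt1 // modnn.
by rewrite mul0r addr0 => /(congr1 val); rewrite /= !val_Zp_nat ?expp_gt1.
Qed.

Lemma modn_expX_lift k a b : a = b %[mod p] -> a ^ (p ^ k) = b ^ (p ^ k) %[mod p ^ k.+1].
Proof.
rewrite -{1 2}[p]expn1 => /padic_natmodP[y ab]; apply/padic_natmodP.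
by rewrite !natrX ab; have [z ->] := expr_pX_lift p_pr p_odd 0 k (b%:R : Zp) y; exists z.
Qed.

Lemma modn_expX_prime a k : a ^ (p ^ k) = a %[mod p].
Proof.
elim: k => [|k IHk]; first by rewrite expn1.
by rewrite expnS mulnC expnM fermat_little.
Qed.

Lemma modn_1p_generator k a : a = 1 %[mod p] -> exists j, a = p.+1 ^ j %[mod p ^ k.+1].
Proof.
move=> a1; elim: k => [|k [j /padic_natmodP[y ay]]].
  by exists 0%N; rewrite expn1 expn0.
have [r [y' yr]] := padic_digit y.
(* (1 + p)^(p^k) is 1 + p^(k+1) modulo p^(k+2), so its r-th power supplies the missing digit r of
   a. *)
have [u pu] : exists u : Zp, (1 + p%:R) ^+ (p ^ k) = 1 + p%:R ^+ k.+1 * (1 + p%:R * u).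
  elim: k {y ay yr} => [|k [u IHk]]; first by exists 0; rewrite !expr1; ring.
  rewrite expnSr exprM IHk; have [z ->] := exprD_lift p_pr p_odd k 1 (1 + p%:R * u : Zp).
  by exists (u + p%:R ^+ k * z); rewrite !expr1n !exprS; ring.
have [v pv] : exists v : Zp, (1 + p%:R) ^+ j = 1 + p%:R * v.
  by have [z ->] := exprDn2 1 (p%:R : Zp) j; rewrite expr1n; eexists.
have [w pw] := exprDn2 1 (p%:R ^+ k.+1 * (1 + p%:R * u) : Zp) r.
exists (j + p ^ k * r)%N; apply/padic_natmodP.
move: ay; rewrite !natrX -!natr1 -[p%:R + 1]addrC exprD exprM pu pw => ->.
rewrite !expr1n pv yr !exprS.
exists (y' - (u * r%:R + v * (1 + p%:R * u) * r%:R +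
  (1 + p%:R * v) * p%:R ^+ k * (1 + p%:R * u) ^+ 2 * w)).
by move: (p%:R ^+ k) => P; rewrite !exprS expr0; ring.
Qed.

End NatCongruences.

Lemma fraction_repr (R : idomainType) (q : {fraction R}) :
  exists a b, b != 0 /\ q * FracField.tofrac b = FracField.tofrac a.
Proof.
elim/quotW: q => x; exists (frac x).1, (frac x).2; split; first exact: denom_ratioP.
unlock FracField.tofrac; rewrite -[LHS]FracField.pi_mul /FracField.mulf.
apply/eqmodP; rewrite /= FracField.equivfE.
by rewrite !numden_Ratio ?(oner_eq0, mulf_neq0, denom_ratioP) // !mulr1 mulrC.
Qed.

(** * Total ramification, and the ring of integers as Z_p[zeta] *)

Section CyclotomicIntegers.
Variables (p : nat) (p_pr : prime p) (K : splittingFieldType (padic_field p_pr)).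
Variables (n : nat) (zeta : K) (zeta_prim : (p ^ n.+1).-primitive_root zeta).
Hypothesis K_gen : <<1; zeta>>%VS = {:K}%VS.
Local Notation Zp := (padic_int p_pr).
Local Notation iota := (@Zp_to_ext p p_pr K).
Local Notation D := (p ^ n.+1)%N.
Local Notation Oint := (@Oint p p_pr K).
Local Notation pi := (zeta - 1).
Implicit Types (x y z : K) (f g : {poly Zp}).

Let p_gt1 := prime_gt1 p_pr.
Let p_gt0 := prime_gt0 p_pr.

(** The ring Z_p[zeta], shown in [Oint_Rz] to be the whole ring of integers. *)
Definition Rz : {pred K} := fun x => `[< exists f, x = peval zeta f >].
Lemma RzP x : reflect (exists f, x = peval zeta f) (x \in Rz).
Proof. exact: asboolP. Qed.

Fact Rz_subring : subring_closed Rz.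
Proof.
split=> [|x y /RzP[f ->] /RzP[g ->]|x y /RzP[f ->] /RzP[g ->]]; apply/RzP.
- by exists 1; rewrite rmorph1.
- by exists (f - g); rewrite rmorphB.
- by exists (f * g); rewrite rmorphM.
Qed.
HB.instance Definition _ := GRing.isSubringClosed.Build K Rz Rz_subring.

Lemma D_gt0 : (0 < D)%N. Proof. by rewrite expn_gt0 p_gt0. Qed.

Lemma zeta_Oint : zeta \in Oint.
Proof. exact: unity_Oint D_gt0 (prim_expr_order zeta_prim). Qed.

Lemma Rz_Oint x : x \in Rz -> x \in Oint.
Proof. by move=> /RzP[f ->]; apply: peval_Oint zeta_Oint. Qed.

Lemma Rz_zeta : zeta \in Rz. Proof. by apply/RzP; exists 'X; rewrite pevalX. Qed.
Lemma Rz_iota (a : Zp) : iota a \in Rz.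
Proof. by apply/RzP; exists a%:P; rewrite pevalC. Qed.

Lemma pi_neq0 : pi != 0.
Proof.
rewrite subr_eq0; apply/eqP => z1; have := prim_order_dvd zeta_prim 1.
by rewrite z1 expr1 eqxx dvdn1 gtn_eqF // -(exp1n n.+1) ltn_exp2r.
Qed.

Lemma sub1_zetaX a : exists2 w, w \in Rz & zeta ^+ a - 1 = pi * w.
Proof.
exists (\sum_(i < a) zeta ^+ i); last by rewrite subrX1.
by rewrite rpred_sum // => i _; rewrite rpredX ?Rz_zeta.
Qed.

Lemma coprime_Dp a : coprime D a = ~~ (p %| a)%N.
Proof. by rewrite coprime_pexpl // prime_coprime. Qed.

(* zeta is itself a power of zeta ^+ a. *)
Lemma pi_sub1_zetaX a : ~~ (p %| a)%N -> exists2 w, w \in Rz & pi = (zeta ^+ a - 1) * w.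
Proof.
rewrite -coprime_Dp coprime_sym => co_a.
have a_gt0 : (0 < a)%N.
  by case: a co_a => //; rewrite /coprime gcd0n gtn_eqF // -(exp1n n.+1) ltn_exp2r.
have [b c bc _] := egcdnP D a_gt0.
have zb : zeta = zeta ^+ a ^+ b.
  rewrite -exprM mulnC bc (eqP co_a) exprD expr1 mulnC exprM.
  by rewrite (prim_expr_order zeta_prim) expr1n mul1r.
exists (\sum_(i < b) zeta ^+ a ^+ i); last by rewrite {1}zb subrX1.
by rewrite rpred_sum // => i _; rewrite !rpredX ?Rz_zeta.
Qed.

(** Both sides are the value at 1 of (X^D - 1) / (X^(p^n) - 1): the factors with p dividing k make
    up the denominator, and the quotient is a geometric sum of p terms. *)
Lemma prod_sub1_zetaX : \prod_(0 <= k < D | ~~ (p %| k)%N) (1 - zeta ^+ k) = p%:R.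
Proof.
have zp_prim : (p ^ n).-primitive_root (zeta ^+ p).
  by have := dvdn_prim_root zeta_prim (dvdn_exp2l p (leqnSn n)); rewrite expnS mulnK ?expn_gt0 ?p_gt0.
have perm_p : perm_eq [seq k <- index_iota 0 D | (p %| k)%N]
    [seq (p * j)%N | j <- index_iota 0 (p ^ n)].
  apply: uniq_perm.
  - by rewrite filter_uniq // iota_uniq.
  - rewrite map_inj_uniq ?iota_uniq // => i j /eqP.
    by rewrite eqn_pmul2l // => /eqP.
  move=> k; rewrite mem_filter mem_index_iota /=; apply/andP/mapP.
    move=> [/dvdnP[j ->]]; rewrite expnS mulnC ltn_pmul2l // => jn.
    by exists j; rewrite ?mem_index_iota // mulnC.
  move=> [j]; rewrite mem_index_iota /= => jn ->.
  by rewrite dvdn_mulr // expnS ltn_pmul2l.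
have := factor_Xn_sub_1 zeta_prim; rewrite (bigID (fun k => p %| k)%N) /=.
rewrite -big_filter (perm_big _ perm_p) big_map.
under eq_bigr do rewrite exprM.
rewrite (factor_Xn_sub_1 zp_prim).
rewrite [in RHS]expnSr exprM [RHS]subrX1.
have Xpn0 : 'X^(p ^ n) - 1 != 0 :> {poly K}.
  by rewrite monic_neq0 // monicXnsubC // expn_gt0 p_gt0.
move=> /(mulfI Xpn0)/(congr1 (fun q => q.[1])); rewrite horner_sum horner_prod.
under [RHS]eq_bigr do rewrite -exprM hornerXn expr1n.
rewrite sumr_const card_ord => <-.
by apply: eq_bigr => k _; rewrite hornerXsubC.
Qed.

(** Each of the [totient D] factors 1 - zeta^k in the product above is an associate of pi in
    Z_p[zeta]. *)
Lemma p_eq_pi_pow :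
  exists v v', [/\ v \in Rz, v' \in Rz, p%:R = pi ^+ totient D * v & v * v' = 1].
Proof.
have prodP (r : seq nat) : exists v v', [/\ v \in Rz, v' \in Rz, v * v' = 1
    & \prod_(k <- r | ~~ (p %| k)%N) (1 - zeta ^+ k) =
      pi ^+ count (fun k => ~~ (p %| k)%N) r * v].
  elim: r => [|k r [v [v' [Rv Rv' vv' IHr]]]].
    by exists 1, 1; rewrite big_nil !mulr1 rpred1.
  rewrite big_cons /=; case: ifP => [pk|_]; last by exists v, v'.
  have [w Rw kw] := sub1_zetaX k; have [w' Rw' kw'] := pi_sub1_zetaX pk.
  exists (- w * v), (- w' * v'); split; rewrite ?rpredM ?rpredN //.
    rewrite mulrACA vv' mulr1 mulrNN.
    by apply: (mulfI pi_neq0); rewrite mulr1 {2}kw' kw mulrA.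
  by rewrite IHr -opprB kw add1n exprS; ring.
have [v [v' [Rv Rv' vv' e]]] := prodP (index_iota 0 D).
exists v, v'; split => //; rewrite -prod_sub1_zetaX e; congr (_ ^+ _ * _).
rewrite totient_count_coprime -sum1_count big_mkcond /=.
by apply: eq_bigr => k _; rewrite coprime_Dp.
Qed.

Lemma p_mul_pi : exists2 w, w \in Rz & p%:R = pi * w.
Proof.
have [v [_ [Rv _ -> _]]] := p_eq_pi_pow.
have : (0 < totient D)%N by rewrite totient_gt0 D_gt0.
case: (totient D) => // d _; exists (pi ^+ d * v); last by rewrite exprS mulrA.
by rewrite rpredM ?rpredX ?rpredB ?rpred1 ?Rz_zeta.
Qed.

Lemma pi_pow_mulp : exists2 w, w \in Rz & pi ^+ totient D = p%:R * w.
Proof.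
have [v [v' [_ Rv' -> vv']]] := p_eq_pi_pow.
by exists v' => //; rewrite -mulrA vv' mulr1.
Qed.

Lemma pi_inv_notin : pi^-1 \notin Oint.
Proof.
apply: contra (pinv_notin_Oint K) => Opi.
have [v [v' [_ Rv' -> vv']]] := p_eq_pi_pow.
have v0 : v != 0 by apply: contra_eq_neq vv' => ->; rewrite mul0r eq_sym oner_neq0.
have -> : (pi ^+ totient D * v)^-1 = pi^-1 ^+ totient D * v'.
  by rewrite invfM exprVn -[v'](mulKf v0) vv' mulr1.
by apply: rpredM; [apply: rpredX|apply: Rz_Oint].
Qed.

Lemma Rz_digit x : x \in Rz ->
  exists (a : Zp) y, y \in Rz /\ x = iota a + pi * y.
Proof.
move=> /RzP[f ->]; have /factor_theorem[g fg] : root (f - (f.[1])%:P) 1.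
  by rewrite /root !hornerE subrr.
exists f.[1], (peval zeta g); split; first by apply/RzP; exists g.
rewrite -[f in LHS](subrK (f.[1])%:P) fg rmorphD rmorphM rmorphB /=.
by rewrite !pevalC pevalX rmorph1 addrC mulrC.
Qed.

Lemma iota_pi (a : Zp) y : y \in Oint -> iota a = pi * y -> exists b, a = p%:R * b.
Proof.
case: (padic_dvd_or_unit a) => // ua Oy ay; case/negP: pi_inv_notin.
have -> : pi^-1 = iota a^-1 * y.
  rewrite rmorphV //= ay invfM mulfVK //.
  apply: contra_eq_neq ay => ->; rewrite mulr0; exact: Zp_to_ext_unit.
by rewrite rpredM ?Oint_iota.
Qed.

(** Write pi y = a + pi z with a in Z_p: then a is divisible by pi among the integers, hence by p in
    Z_p, hence by pi in Z_p[zeta]. Division by p follows, and it suffices for [Oint_Rz] because all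
    denominators in K are powers of p. *)
Lemma Rz_div_pi y : y \in Oint -> pi * y \in Rz -> y \in Rz.
Proof.
move=> Oy /Rz_digit[a [z [Rz_z e]]].
have ay : iota a = pi * (y - z) by rewrite mulrBr e addrK.
have [b ab] := iota_pi (rpredB Oy (Rz_Oint Rz_z)) ay.
have [w Rw pw] := p_mul_pi.
have -> : y = w * iota b + z.
  by apply: (mulfI pi_neq0); rewrite e ab rmorphM rmorph_nat pw mulrDr mulrA.
by rewrite rpredD ?rpredM ?Rz_iota.
Qed.

Lemma Rz_div_pi_pow k y : y \in Oint -> pi ^+ k * y \in Rz -> y \in Rz.
Proof.
move=> Oy; elim: k => [|k IHk]; first by rewrite mul1r.
rewrite exprS -mulrA => /Rz_div_pi; rewrite rpredM // ?rpredX ?rpredB ?rpred1 ?zeta_Oint //.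
by move=> /(_ isT).
Qed.

Lemma Rz_divp y : y \in Oint -> p%:R * y \in Rz -> y \in Rz.
Proof.
have [w Rw e] := pi_pow_mulp => Oy Ry; apply: (Rz_div_pi_pow Oy (k := totient D)).
by rewrite e mulrAC rpredM.
Qed.

Lemma denominator x : exists c, p%:R ^+ c * x \in Rz.
Proof.
have : x \in <<1; zeta>>%VS by rewrite K_gen memvf.
case/Fadjoin1_polyP => f ->.
have [c cf] : exists c, forall i, (i < size f)%N -> p%:R ^+ c * (f`_i)%:A \in Rz.
  elim: (size f) => [|m [c IHc]]; first by exists 0%N.
  have [a [b [b0 ab]]] := fraction_repr f`_m.
  have [k [u [uu bk]]] := padic_factor b0.
  exists (c + k)%N => i; rewrite ltnS leq_eqVlt => /predU1P[->|/IHc Ri].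
    rewrite exprD -mulrA rpredM ?rpredX ?rpred_nat //.
    have -> : p%:R ^+ k * (f`_m)%:A = iota (a * u^-1); last exact: Rz_iota.
    apply: (mulIf (Zp_to_ext_unit K uu)); rewrite -rmorphM mulrVK //.
    rewrite mulrAC -(rmorph_nat iota) -rmorphXn -rmorphM /= -bk /Zp_to_ext -ab.
    by rewrite -scalerAl mul1r scalerA mulrC.
  by rewrite exprD mulrAC rpredM ?rpredX ?rpred_nat.
exists c; rewrite horner_coef mulr_sumr rpred_sum // => i _.
rewrite size_map_inj_poly ?rmorph0 // in i *; last exact: fmorph_inj.
by rewrite coef_map mulrA rpredM ?cf ?rpredX ?Rz_zeta.
Qed.

Lemma Oint_Rz x : (x \in Oint) = (x \in Rz).
Proof.
apply/idP/idP => [Ox|/Rz_Oint //]; have [c] := denominator x.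
elim: c => [|c IHc]; first by rewrite mul1r.
by rewrite exprS -mulrA => /Rz_divp Rx; apply/IHc/Rx; rewrite rpredM ?rpredX ?rpred_nat.
Qed.

(** If x is not 0, p^c / x is integral for some c, and x in p^(c+1) O_K would make 1/p integral.
    This is what makes limits unique. *)
Lemma Opow_sep x : (forall N, x \in @Opow p p_pr K N) -> x = 0.
Proof.
move=> xN; have [//|x0] := eqVneq x 0; have [c Rc] := denominator x^-1.
case/negP: (pinv_notin_Oint K).
suff : p%:R ^+ c * 1 \in @Opow p p_pr K (c + 1).
  by rewrite Opow_mulpX OpowE mulr1 expr1.
rewrite mulr1 -[X in X \in _](mulfVK x0) OpowMl //.
by rewrite Oint_Rz.
Qed.
End CyclotomicIntegers.

(** * The Galois group of K as the units modulo p^(n+1) *)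

Section GaloisGroup.
Variables (p : nat) (p_pr : prime p) (K : splittingFieldType (padic_field p_pr)).
Variables (n : nat) (zeta : K) (zeta_prim : (p ^ n.+1).-primitive_root zeta).
Hypothesis K_gen : <<1; zeta>>%VS = {:K}%VS.
Local Notation Zp := (padic_int p_pr).
Local Notation iota := (@Zp_to_ext p p_pr K).
Local Notation D := (p ^ n.+1)%N.
Local Notation Oint := (@Oint p p_pr K).
Local Notation pi := (zeta - 1).
Local Notation galK := (gal_of {:K}).
Implicit Types (x y z : K) (f g : {poly Zp}) (s t : galK).

Let pK0 := pK_neq0 K.
Let p_gt1 := prime_gt1 p_pr.

Lemma mem_Gal1 s : s \in 'Gal({:K} / 1)%g.
Proof. by rewrite gal_kHom ?sub1v // k1AHom. Qed.

Lemma gal_zetaP s : exists2 a, ~~ (p %| a)%N & s zeta = zeta ^+ a.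
Proof.
have [a co_a ->] := aut_prim_rootP s zeta_prim.
by exists a => //; rewrite -(coprime_Dp p_pr n) coprime_sym.
Qed.

Lemma gal_inj s t : s zeta = t zeta -> s = t.
Proof.
move=> st; apply/eqP/gal_eqP => x _.
have [c /RzP[f xf]] := denominator K_gen x.
have := gal_peval t zeta f; rewrite -st -gal_peval -xf !rmorphM /= !rmorphXn /= !rmorph_nat.
by move/(mulfI (expf_neq0 c pK0)).
Qed.

Lemma gal_pi s : exists w w', [/\ w \in Oint, w' \in Oint, s pi = pi * w & w * w' = 1].
Proof.
have [a pa sa] := gal_zetaP s.
have [w Rw kw] := sub1_zetaX zeta a; have [w' Rw' kw'] := pi_sub1_zetaX zeta_prim pa.
exists w, w'; rewrite !(Rz_Oint zeta_prim) // rmorphB rmorph1 /= sa kw; split => //.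
by apply: (mulfI (pi_neq0 zeta_prim)); rewrite mulr1 {2}kw' kw mulrA.
Qed.

(** A comparison of pi-adic valuations: v is an integral inverse of w', so b < a would make 1/pi
    integral. *)
Lemma pi_pow_le a b w w' v : w \in Oint -> v \in Oint -> w' * v = 1 ->
  pi ^+ a * w = pi ^+ b * w' -> (a <= b)%N.
Proof.
move=> Ow Ov wv e; rewrite leqNgt; apply/negP => ba.
case/negP: (pi_inv_notin zeta_prim).
have pi0 := pi_neq0 zeta_prim.
suff -> : pi^-1 = pi ^+ (a - b.+1) * (w * v).
  by rewrite !rpredM ?rpredX ?rpredB ?rpred1 ?(zeta_Oint zeta_prim).
apply: (mulfI pi0); rewrite mulfV // mulrA -exprS subnSK //.
apply: (mulfI (expf_neq0 b pi0)); rewrite mulr1 mulrA -exprD subnKC ?(ltnW ba) //.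
by rewrite mulrA e -mulrA wv mulr1.
Qed.

Lemma galois_1K : galois 1 {:K}.
Proof.
rewrite /galois sub1v normalFieldf andbT /=; apply/separableP => x _.
apply: pcharf0_separable => q; rewrite inE /= [_ \in pred0]inE; apply/negbTE/negP.
by move=> /andP[q_pr]; rewrite (negbTE (natK_neq0 K (prime_gt0 q_pr))).
Qed.

(* The norm of pi, an associate of pi ^+ #|G|, lies in Q_p, where p is an
   associate of pi ^+ totient D: hence totient D divides #|G|. *)
Lemma leq_card_gal : (totient D <= #|{: galK}|)%N.
Proof.
have pi0 := pi_neq0 zeta_prim.
have prodP (r : seq galK) : exists w w', [/\ w \in Oint, w' \in Oint, w * w' = 1
    & \prod_(s <- r) (s : galK) pi = pi ^+ size r * w].
  elim: r => [|s r [w [w' [Ow Ow' ww' IHr]]]].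
    by exists 1, 1; rewrite big_nil !mulr1 rpred1.
  have [v [v' [Ov Ov' sv vv']]] := gal_pi s.
  exists (v * w), (v' * w'); split; rewrite ?rpredM // ?big_cons ?sv ?IHr.
    by rewrite mulrACA vv' ww' mulr1.
  by rewrite exprS mulrACA.
have [w [w' [Ow Ow' ww' Npi]]] := prodP (index_enum galK).
have := mem_galNorm galois_1K (memvf pi).
have -> : galNorm 1 {:K} pi = \prod_(s : galK) (s : galK) pi.
  by apply: eq_bigl => s; rewrite mem_Gal1.
rewrite {}Npi; set g := size _ => /vlineP[q Nq].
have -> : #|{: galK}| = g by rewrite cardE enumT.
have g0 : (0 < g)%N.
  rewrite /g; have : (1%g : galK) \in index_enum galK by rewrite mem_index_enum.
  by case: index_enum.
have [a [b [b0 qb]]] := fraction_repr q.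
have [i [u [uu bu]]] := padic_factor b0.
have a0 : a != 0.
  apply: contraTneq (isT) => a0; move/eqP: qb; rewrite a0 tofrac0 mulf_eq0.
  rewrite tofrac_eq0 (negbTE b0) orbF => /eqP q0; move/eqP: Nq; rewrite q0 scale0r.
  rewrite mulf_eq0 expf_eq0 (negbTE pi0) andbF /=.
  by move/eqP: ww' => /[swap] /eqP ->; rewrite mul0r eq_sym oner_eq0.
have [j [u' [uu' au']]] := padic_factor a0.
have [v [v' [Rv Rv' pv vv']]] := p_eq_pi_pow zeta_prim.
have e : (pi ^+ g * w) * iota b = iota a.
  by rewrite Nq /Zp_to_ext -scalerAl mul1r scalerA qb.
have {}e : pi ^+ (g + totient D * i) * (w * v ^+ i * iota u) =
    pi ^+ (totient D * j) * (v ^+ j * iota u').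
  transitivity (iota a); last first.
    by rewrite au' rmorphM rmorphXn /= rmorph_nat pv exprMn -exprM mulrA.
  rewrite -e bu rmorphM rmorphXn /= rmorph_nat pv exprMn -exprM exprD.
  by rewrite -!(mulrA _ (v ^+ i)) mulrACA.
have Oi (x : Zp) : iota x \in Oint := Oint_iota K x.
have iotaV (x : Zp) : x \is a GRing.unit -> iota x * iota x^-1 = 1.
  by move=> ux; rewrite -rmorphM divrr // rmorph1.
have RO := Rz_Oint zeta_prim.
have le1 : (g + totient D * i <= totient D * j)%N.
  apply: (pi_pow_le (v := v' ^+ j * iota u'^-1) _ _ _ e).
  - by do ?[exact: Oi|exact: RO|apply: rpredM|apply: rpredX].
  - by do ?[exact: Oi|exact: RO|apply: rpredM|apply: rpredX].
  - by rewrite mulrACA -exprMn vv' expr1n iotaV // mulr1.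
have le2 : (totient D * j <= g + totient D * i)%N.
  apply: (pi_pow_le (v := w' * v' ^+ i * iota u^-1) _ _ _ (esym e)).
  - by do ?[exact: Oi|exact: RO|apply: rpredM|apply: rpredX].
  - by do ?[exact: Oi|exact: RO|apply: rpredM|apply: rpredX].
  - by rewrite mulrACA iotaV // mulr1 mulrACA ww' -exprMn vv' expr1n mulr1.
have {le1 le2} gE : (g + totient D * i = totient D * j)%N.
  by apply/eqP; rewrite eqn_leq le1 le2.
apply: dvdn_leq => //.
by rewrite -(dvdn_addl _ (dvdn_mulr i (dvdnn _))) gE dvdn_mulr.
Qed.

Definition sigma (a : nat) : galK := odflt 1%g [pick s : galK | s zeta == zeta ^+ a].

(** Existence by counting: the exponent of s zeta embeds the Galois group into the units modulo [D],
    and [leq_card_gal] forces the embedding to be onto. *)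
Lemma sigmaE a : ~~ (p %| a)%N -> sigma a zeta = zeta ^+ a.
Proof.
move=> pa; rewrite /sigma; case: pickP => [s /eqP //|no_s].
have z_order (s : galK) : s zeta ^+ D = 1.
  by rewrite -rmorphXn (prim_expr_order zeta_prim) rmorph1.
pose h (s : galK) := sval (prim_rootP zeta_prim (z_order s)).
have hE (s : galK) : s zeta = zeta ^+ h s := svalP (prim_rootP zeta_prim (z_order s)).
have h_inj : injective h by move=> s t hst; apply: gal_inj; rewrite !hE hst.
pose A := [set i : 'I_D | coprime i D].
have sub_hA : h @: finset.setT \subset A.
  apply/fintype.subsetP => _ /imsetP[s _ ->]; rewrite inE.
  by rewrite -(prim_root_exp_coprime _ zeta_prim) -hE fmorph_primitive_root.
have cardA : #|A| = totient D.
  rewrite totient_count_coprime big_mkord -sum1_card big_mkcond /=.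
  by apply: eq_bigr => i _; rewrite inE coprime_sym; case: coprime.
have : h @: finset.setT = A.
  by apply/eqP; rewrite eqEcard sub_hA cardA card_imset // cardsT leq_card_gal.
have aD : (a %% D < D)%N by rewrite ltn_mod (D_gt0 p_pr).
move/setP/(_ (Ordinal aD)); rewrite [in RHS]inE /= coprime_modl.
rewrite coprime_sym (coprime_Dp p_pr) pa => /imsetP[s _ /(congr1 val) /= hs].
by have := no_s s; rewrite hE -hs (prim_expr_mod zeta_prim) eqxx.
Qed.

Lemma sigma_mod a b : a = b %[mod D] -> sigma a = sigma b.
Proof.
move=> ab; rewrite /sigma; suff -> : zeta ^+ a = zeta ^+ b by [].
by apply/eqP; rewrite (eq_prim_root_expr zeta_prim) ab.
Qed.

Lemma gal_sigma s : exists2 a, ~~ (p %| a)%N & s = sigma a.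
Proof.
by have [a pa sa] := gal_zetaP s; exists a => //; apply: gal_inj; rewrite sigmaE.
Qed.

Lemma galMx s t x : (s * t)%g x = t (s x).
Proof. by rewrite galM ?memvf. Qed.

Lemma galC s t : (s * t = t * s)%g.
Proof.
have [a pa ->] := gal_sigma s; have [b pb ->] := gal_sigma t.
by apply: gal_inj; rewrite !galMx !sigmaE // !rmorphXn /= !sigmaE // -!exprM mulnC.
Qed.

Lemma sigmaM a b : ~~ (p %| a)%N -> ~~ (p %| b)%N ->
  sigma (a * b) = (sigma a * sigma b)%g.
Proof.
move=> pa pb; apply: gal_inj; rewrite sigmaE; last first.
  by rewrite Euclid_dvdM // negb_or pa.
by rewrite galMx sigmaE // rmorphXn /= sigmaE // exprM -!exprM mulnC.
Qed.

Lemma sigmaX a j : ~~ (p %| a)%N -> sigma (a ^ j) = (sigma a ^+ j)%g.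
Proof.
move=> pa; elim: j => [|j IHj].
  apply: gal_inj; rewrite expn0 expg0 gal_id sigmaE ?expr1 //.
  by rewrite dvdn1 gtn_eqF.
by rewrite expnS expgS sigmaM // ?IHj // Euclid_dvdX // negb_and pa.
Qed.

End GaloisGroup.

(** * The trace T over Delta, and the generator gamma of Gamma *)

Section TraceDelta.
Variables (p : nat) (p_pr : prime p) (p_odd : odd p).
Variables (K : splittingFieldType (padic_field p_pr)).
Variables (n : nat) (zeta : K) (zeta_prim : (p ^ n.+1).-primitive_root zeta).
Hypothesis K_gen : <<1; zeta>>%VS = {:K}%VS.
Local Notation Zp := (padic_int p_pr).
Local Notation iota := (@Zp_to_ext p p_pr K).
Local Notation D := (p ^ n.+1)%N.
Local Notation Oint := (@Oint p p_pr K).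
Local Notation galK := (gal_of {:K}).
Local Notation T := (T_Delta n zeta).
Local Notation sigma := (sigma zeta).
Implicit Types (x y z : K) (f g P Q : {poly Zp}) (s t : galK).

Let p_gt1 := prime_gt1 p_pr.
Let p_gt0 := prime_gt0 p_pr.
Let sE := sigmaE zeta_prim K_gen.

Fact T_zmod_morphism : zmod_morphism T.
Proof. by move=> x y; rewrite /T_Delta -sumrB; apply: eq_bigr => s _; rewrite rmorphB. Qed.
HB.instance Definition _ := GRing.isZmodMorphism.Build K K T T_zmod_morphism.

Lemma T_gal s x : T (s x) = s (T x).
Proof.
rewrite /T_Delta rmorph_sum; apply: eq_bigr => t _ /=.
by rewrite -!galMx (galC zeta_prim K_gen).
Qed.

Lemma T_fixedl c x : (forall s, s c = c) -> T (c * x) = c * T x.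
Proof.
by move=> sc; rewrite /T_Delta mulr_sumr; apply: eq_bigr => s _; rewrite rmorphM /= sc.
Qed.

Lemma T_iota (a : Zp) x : T (iota a * x) = iota a * T x.
Proof. by apply: T_fixedl => s; rewrite galK_iota. Qed.

Lemma T_pX k x : T (p%:R ^+ k * x) = p%:R ^+ k * T x.
Proof. by apply: T_fixedl => s; rewrite rmorphXn /= rmorph_nat. Qed.

Lemma T_pXV k x : T (p%:R ^- k * x) = p%:R ^- k * T x.
Proof. by apply: T_fixedl => s; rewrite fmorphV rmorphXn /= rmorph_nat. Qed.

Lemma T_Opow N x : x \in @Opow p p_pr K N -> T x \in @Opow p p_pr K N.
Proof. by move=> xN; apply: rpred_sum => s _; apply: gal_Opow. Qed.

Lemma ndvdX a k : ~~ (p %| a)%N -> ~~ (p %| a ^ k)%N.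
Proof. by move=> pa; rewrite Euclid_dvdX // negb_and pa. Qed.

Lemma mem_Delta a : ~~ (p %| a)%N -> (sigma a \in Delta n zeta) = (a ^ (p - 1) == 1 %[mod D]).
Proof.
move=> pa; rewrite inE mem_Gal1 /= sE //; apply/existsP/idP => [[i /andP[/eqP ai]]|a1].
  have /eqP := ai; rewrite (eq_prim_root_expr zeta_prim) => /eqP {}ai.
  by rewrite -modnXm -ai modnXm.
have aD : (a %% D < D)%N by rewrite ltn_mod (D_gt0 p_pr).
by exists (Ordinal aD); rewrite /= (prim_expr_mod zeta_prim) eqxx /= modnXm.
Qed.

(** a^(p^n) represents the Teichmuller lift of a to Z/p^(n+1); its order divides p - 1 by Euler's
    theorem. *)
Lemma Teichmuller_Delta a : ~~ (p %| a)%N -> sigma (a ^ (p ^ n)) \in Delta n zeta.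
Proof.
move=> pa; rewrite mem_Delta ?ndvdX // -expnM subn1.
have -> : (p ^ n * p.-1 = totient D)%N by rewrite totient_pfactor // mulnC.
by apply/eqP/Euler_exp_totient; rewrite coprime_sym (coprime_Dp p_pr).
Qed.

Lemma DeltaP s : s \in Delta n zeta ->
  exists2 c : 'I_p, c != 0%N :> nat & s = sigma (c ^ (p ^ n)).
Proof.
have [a pa ->] := gal_sigma zeta_prim K_gen s.
rewrite mem_Delta // => /eqP a1.
have cp : (a %% p < p)%N by rewrite ltn_mod.
exists (Ordinal cp) => /=; first exact: pa.
apply: (sigma_mod zeta_prim).
rewrite -(modn_expX_lift p_pr p_odd n (esym (modn_mod a p))).
(* p^n is 1 modulo p - 1, so raising to the power p^n fixes every a with a^(p-1) = 1. *)
have -> : (p ^ n = 1 + (p - 1) * (\sum_(i < n) p ^ i))%N.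
  by rewrite subn1 -predn_exp add1n prednK // expn_gt0 p_gt0.
by rewrite expnD expn1 expnM -modnMmr -modnXm a1 modnXm exp1n modnMmr muln1.
Qed.

Lemma ndvd_ord (c : 'I_p) : (c != 0%N :> nat) = ~~ (p %| c)%N.
Proof.
case: c => -[|c] cp /=; first by rewrite dvdn0.
by rewrite gtnNdvd.
Qed.

Lemma T_sum x : T x = \sum_(c < p | c != 0%N :> nat) sigma (c ^ (p ^ n)) x.
Proof.
have -> : T x = \sum_(s in [set sigma (c ^ (p ^ n)) | c : 'I_p in [set c : 'I_p | c != 0%N :> nat]])
    (s : galK) x.
  apply: eq_bigl => s; apply/idP/imsetP => [/DeltaP[c c0 ->]|[c]].
    by exists c; rewrite ?inE.
  by rewrite inE ndvd_ord => /Teichmuller_Delta + ->.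
rewrite big_imset /=; first by apply: eq_bigl => c; rewrite inE.
move=> c d; rewrite !inE !ndvd_ord => pc pd /(congr1 (fun s : galK => s zeta)).
rewrite !sE ?ndvdX // => /eqP; rewrite (eq_prim_root_expr zeta_prim) => /eqP cd.
apply: val_inj => /=; rewrite -[LHS](modn_small (ltn_ord c)) -[RHS](modn_small (ltn_ord d)).
rewrite -(modn_expX_prime p_pr c n) -(modn_expX_prime p_pr d n).
have pD : (p %| D)%N by rewrite expnS dvdn_mulr.
by rewrite -(modn_dvdm _ pD) cd modn_dvdm.
Qed.

Lemma sigma_unity a w : ~~ (p %| a)%N -> w ^+ D = 1 -> sigma a w = w ^+ a.
Proof.
move=> pa /(prim_rootP zeta_prim)[i ->].
by rewrite rmorphXn /= sE // -!exprM mulnC.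
Qed.

(** On p-th roots of unity the Teichmuller lift of c acts as c itself, so that T w is the sum of the
    w^c for 0 < c < p. *)
Lemma T_unity w : w ^+ p = 1 -> T w = if w == 1 then p%:R - 1 else -1.
Proof.
move=> wp; have wD : w ^+ D = 1 by rewrite expnS exprM wp expr1n.
have -> : T w = \sum_(c < p | c != 0%N :> nat) w ^+ c.
  rewrite T_sum; apply: eq_bigr => c; rewrite ndvd_ord => pc.
  rewrite sigma_unity ?ndvdX //; apply/eqP.
  by rewrite -(expr_mod _ wp) -(modn_expX_prime p_pr c n) expr_mod.
have -> : \sum_(c < p | c != 0%N :> nat) w ^+ c = \sum_(c < p) w ^+ c - 1.
  rewrite [in RHS](bigD1 (Ordinal p_gt0)) //= expr0 addrC addrK.
  by apply: eq_bigl => c.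
have [->|w1] := eqVneq w 1.
  by under eq_bigr do rewrite expr1n; rewrite sumr_const card_ord.
have : (w - 1) * \sum_(c < p) w ^+ c = 0 by rewrite -subrX1 wp subrr.
by move/eqP; rewrite mulf_eq0 subr_eq0 (negbTE w1) => /eqP ->; rewrite add0r.
Qed.

Lemma T1 : T 1 = p%:R - 1.
Proof. by rewrite T_unity ?expr1n ?eqxx. Qed.

Lemma Delta_mul s t : s \in Delta n zeta -> t \in Delta n zeta -> (s * t)%g \in Delta n zeta.
Proof.
move=> /DeltaP[c c0 ->] /DeltaP[d d0 ->]; rewrite ndvd_ord in c0; rewrite ndvd_ord in d0.
rewrite -(sigmaM zeta_prim K_gen) ?ndvdX // -expnMn Teichmuller_Delta //.
by rewrite Euclid_dvdM // negb_or c0.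
Qed.

Lemma T_Delta_mem s x : s \in Delta n zeta -> T (s x) = T x.
Proof.
move=> Ds; have DsE : [set (t * s)%g | t in Delta n zeta] = Delta n zeta.
  apply/eqP; rewrite eqEcard card_imset ?leqnn ?andbT; last exact: mulIg.
  by apply/fintype.subsetP => _ /imsetP[u Du ->]; apply: Delta_mul.
rewrite [in RHS]/T_Delta -DsE big_imset /=; last by move=> u v _ _; apply: mulIg.
by rewrite T_gal /T_Delta rmorph_sum; apply: eq_bigr => t _; rewrite galMx.
Qed.

Lemma mem_Gamma s : (s \in Gamma n zeta) = (s (zeta_ n zeta 0) == zeta_ n zeta 0).
Proof.
rewrite /Gamma; apply/idP/eqP => [/fixed_gal-> //|s0].
- exact: subvf.
- exact: memv_adjoin.
rewrite gal_kHom ?subvf //; apply/kAHomP => x /Fadjoin1_polyP[f ->].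
rewrite -horner_map /= -map_poly_comp s0; congr (_.[_]); apply: eq_map_poly => q /=.
by rewrite linearZ rmorph1.
Qed.

Definition gamma := sigma p.+1.

Lemma ndvd_1pX (k : nat) : (0 < k)%N -> ~~ (p %| (1 + p ^ k))%N.
Proof.
by case: k => // k _; rewrite dvdn_addl ?expnS ?dvdn_mulr // dvdn1 gtn_eqF.
Qed.

Lemma ndvd_p1 : ~~ (p %| p.+1)%N.
Proof. by rewrite -add1n -{2}(expn1 p) ndvd_1pX. Qed.

(** Fixing zeta_0 = zeta^(p^n) forces the exponent of s to be 1 modulo p, and such residues are
    powers of 1 + p. *)
Lemma GammaP s : s \in Gamma n zeta -> exists j, s = (gamma ^+ j)%g.
Proof.
rewrite mem_Gamma; have [a pa ->] := gal_sigma zeta_prim K_gen s.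
rewrite /zeta_ subn0 rmorphXn /= sE // -exprM (eq_prim_root_expr zeta_prim).
rewrite mulnC -[X in _ == X %[mod _]]muln1 expnSr -!muln_modr eqn_pmul2l ?expn_gt0 ?p_gt0 //.
move/eqP => a1; have [j aj] := modn_1p_generator p_pr p_odd n a1.
exists j; rewrite -(sigmaX zeta_prim K_gen) ?ndvd_p1 //; exact: (sigma_mod zeta_prim).
Qed.

Lemma gamma_Gamma j : (gamma ^+ j)%g \in Gamma n zeta.
Proof.
apply: groupX; rewrite mem_Gamma /zeta_ subn0 rmorphXn /= sE ?ndvd_p1 //.
by rewrite -exprM mulSn exprD mulnC -expnSr (prim_expr_order zeta_prim) mulr1.
Qed.

(* sigma b = delta * gamma ^+ j with delta the Teichmuller part of b. *)
Lemma T_sigma b : ~~ (p %| b)%N -> exists j, forall x, T (sigma b x) = (gamma ^+ j)%g (T x).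
Proof.
move=> pb; set d := sigma (b ^ (p ^ n)); have Dd : d \in Delta n zeta := Teichmuller_Delta pb.
have bd : sigma b (zeta_ n zeta 0) = d (zeta_ n zeta 0).
  have wp : zeta_ n zeta 0 ^+ p = 1.
    by rewrite /zeta_ subn0 -exprM -expnSr (prim_expr_order zeta_prim).
  have wD : zeta_ n zeta 0 ^+ D = 1 by rewrite expnS exprM wp expr1n.
  rewrite /d !sigma_unity ?ndvdX //.
  by rewrite -(expr_mod _ wp) -(modn_expX_prime p_pr b n) expr_mod.
have [|j bj] := @GammaP (sigma b * d^-1)%g.
  by rewrite mem_Gamma galMx bd -galMx mulgV gal_id.
exists j => x; rewrite -bj -T_gal galMx.
by rewrite -[RHS](T_Delta_mem _ Dd) -galMx mulVg gal_id.
Qed.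

End TraceDelta.

(** * Polynomials in an automorphism acting on K *)

Section PolynomialAction.
Variables (p : nat) (p_pr : prime p) (K : splittingFieldType (padic_field p_pr)).
Local Notation Zp := (padic_int p_pr).
Local Notation iota := (@Zp_to_ext p p_pr K).
Local Notation galK := (gal_of {:K}).
Implicit Types (x y z : K) (P Q : {poly Zp}) (s t : galK).

(** The action of P(s). For s = gamma these polynomials stand for the elements of Z_p[Gamma]:
    products become polynomial products, and the augmentation is P(1). *)
Definition pact s P x : K := \sum_(i < size P) iota P`_i * (s ^+ i)%g x.

Lemma pact_widen s P x m : (size P <= m)%N ->
  pact s P x = \sum_(i < m) iota P`_i * (s ^+ i)%g x.
Proof.
move=> Pm; rewrite /pact (big_ord_widen m (fun i => iota P`_i * (s ^+ i)%g x) Pm).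
rewrite big_mkcond; apply: eq_bigr => i _ /=; case: ltnP => // Pi.
by rewrite nth_default // rmorph0 mul0r.
Qed.

Fact pact_zmod_morphism s P : zmod_morphism (pact s P).
Proof.
by move=> x y; rewrite /pact -sumrB; apply: eq_bigr => i _; rewrite rmorphB /= mulrBr.
Qed.
HB.instance Definition _ s P :=
  GRing.isZmodMorphism.Build K K (pact s P) (pact_zmod_morphism s P).

Lemma pactDp s P Q x : pact s (P + Q) x = pact s P x + pact s Q x.
Proof.
pose m := maxn (size P) (size Q).
rewrite !(@pact_widen s _ x m) ?leq_maxl ?leq_maxr //; last first.
  exact: leq_trans (size_polyD _ _) _.
by rewrite -big_split; apply: eq_bigr => i _; rewrite coefD rmorphD mulrDl.
Qed.

Lemma pactC s (a : Zp) x : pact s a%:P x = iota a * x.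
Proof.
rewrite (@pact_widen s _ x 1) ?size_polyC_leq1 // big_ord1 coefC /=.
by rewrite expg0 gal_id.
Qed.

Lemma pact0 s x : pact s 0 x = 0. Proof. by rewrite -(polyC0) pactC rmorph0 mul0r. Qed.

Lemma pact_sum s (I : Type) (r : seq I) (F : I -> {poly Zp}) x :
  pact s (\sum_(i <- r) F i) x = \sum_(i <- r) pact s (F i) x.
Proof.
by elim: r => [|i r IHr]; rewrite ?big_nil ?pact0 // !big_cons pactDp IHr.
Qed.

Lemma pactMX s P x : pact s (P * 'X) x = pact s P (s x).
Proof.
rewrite (@pact_widen s (P * 'X) x (size P).+1); last first.
  by apply: leq_trans (size_polyMleq _ _) _; rewrite size_polyX addn2.
rewrite big_ord_recl coefMX /= rmorph0 mul0r add0r; apply: eq_bigr => i _.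
by rewrite coefMX /= expgS galMx.
Qed.

Lemma pact_comm s t P x : (forall u v : galK, (u * v = v * u)%g) ->
  pact s P (t x) = t (pact s P x).
Proof.
move=> comm; rewrite /pact rmorph_sum; apply: eq_bigr => i _ /=.
by rewrite rmorphM /= galK_iota -!galMx comm.
Qed.

Lemma pactZ s (a : Zp) P x : pact s (a *: P) x = iota a * pact s P x.
Proof.
rewrite (@pact_widen s _ x (size P)); last exact: size_scale_leq.
by rewrite mulr_sumr; apply: eq_bigr => i _; rewrite coefZ rmorphM mulrA.
Qed.

Lemma pact_iota s P (a : Zp) x : pact s P (iota a * x) = iota a * pact s P x.
Proof.
rewrite /pact mulr_sumr; apply: eq_bigr => i _.
by rewrite rmorphM /= galK_iota mulrCA.
Qed.

Lemma pactM s P Q x : (forall u v : galK, (u * v = v * u)%g) ->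
  pact s (P * Q) x = pact s P (pact s Q x).
Proof.
move=> comm; elim/poly_ind: P x => [|P a IHP] x; first by rewrite mul0r !pact0.
rewrite mulrDl !pactDp mul_polyC pactZ pactC -mulrA ['X * _]mulrC mulrA.
by rewrite !pactMX IHP pact_comm.
Qed.

Lemma pactXn s j x : pact s 'X^j x = (s ^+ j)%g x.
Proof.
rewrite (@pact_widen s _ x j.+1) ?size_polyXn // big_ord_recr big1 /= => [|i _].
  by rewrite add0r coefXn eqxx rmorph1 mul1r.
by rewrite coefXn ltn_eqF // rmorph0 mul0r.
Qed.

Lemma pact_fixed s P x : s x = x -> pact s P x = iota P.[1] * x.
Proof.
move=> sx; rewrite horner_coef rmorph_sum mulr_suml; apply: eq_bigr => i _ /=.
rewrite expr1n mulr1; congr (_ * _).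
by elim: (i : nat) => [|j IHj]; rewrite ?gal_id // expgS galMx sx.
Qed.

Lemma pact_Opow s P N x : x \in @Opow p p_pr K N -> pact s P x \in @Opow p p_pr K N.
Proof.
by move=> Nx; apply: rpred_sum => i _; rewrite OpowMl ?Oint_iota ?gal_Opow.
Qed.

End PolynomialAction.

(** * Cyclic Z_p[Gamma]-modules, and T on the sums attached to powers of zeta *)

Section CyclicModule.
Variables (p : nat) (p_pr : prime p) (p_odd : odd p).
Variables (K : splittingFieldType (padic_field p_pr)).
Variables (n : nat) (zeta : K) (zeta_prim : (p ^ n.+1).-primitive_root zeta).
Hypothesis K_gen : <<1; zeta>>%VS = {:K}%VS.
Local Notation Zp := (padic_int p_pr).
Local Notation iota := (@Zp_to_ext p p_pr K).
Local Notation D := (p ^ n.+1)%N.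
Local Notation galK := (gal_of {:K}).
Local Notation T := (T_Delta n zeta).
Local Notation sigma := (sigma zeta).
Local Notation gamma := (gamma zeta).
Local Notation t := (T_Delta n zeta (Ttilde n zeta)).
Implicit Types (x y z : K) (f g P Q : {poly Zp}).

Let pK0 := pK_neq0 K.
Let p_gt1 := prime_gt1 p_pr.
Let p_gt0 := prime_gt0 p_pr.

Lemma cyclic_moduleP x y : cyclic_module n zeta x y <-> exists P, y = pact gamma P x.
Proof.
split=> [[a _ <-]|[P ->]].
  have /choice[j jP] (s : galK) : exists j, s \in Gamma n zeta -> s = (gamma ^+ j)%g.
    have [Gs|nGs] := boolP (s \in Gamma n zeta); last by exists 0%N.
    by have [j ->] := GammaP p_odd zeta_prim K_gen Gs; exists j.
  exists (\sum_(s in Gamma n zeta) (a s *: 'X^(j s))).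
  rewrite /group_ring_act -!big_enum pact_sum !big_enum /=; apply: eq_bigr => s Gs.
  by rewrite pactZ pactXn -jP // -[in LHS](mul1r (_ x)) scalerAl.
(* The powers of gamma repeat when the degree of P reaches the order of gamma, so the coefficients
   of equal powers are collected. *)
pose a (s : galK) := \sum_(i < size P | (gamma ^+ i)%g == s) P`_i.
exists a => //; rewrite /group_ring_act /pact.
rewrite [RHS](partition_big (fun i : 'I_(size P) => (gamma ^+ i)%g) (mem (Gamma n zeta))) /=.
  apply: eq_bigr => s Gs; rewrite /a rmorph_sum /= scaler_suml.
  apply: eq_bigr => i /eqP <-.
  by rewrite -[in LHS](mul1r ((gamma ^+ i)%g x)) scalerAl.
by move=> i _; apply: gamma_Gamma.
Qed.

Lemma cyclic_module_p y : cyclic_module n zeta p%:R y <-> exists a, y = iota a * p%:R.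
Proof.
rewrite cyclic_moduleP; split=> [[P ->]|[a ->]].
  by exists P.[1]; rewrite pact_fixed // rmorph_nat.
by exists a%:P; rewrite pactC.
Qed.

Lemma zeta_unity i : (zeta ^+ i) ^+ D = 1.
Proof. by rewrite exprAC (prim_expr_order zeta_prim) expr1n. Qed.

(* Ttilde at the lower level m <= n of the tower. *)
Definition Ttilde_ m : K := \sum_(1 <= i < m.+1) p%:R ^- (m - i) * zeta_ n zeta i.

(** The right-hand side is a trace over the automorphisms that fix zeta_m. A term with i <= m is
    fixed, and the factor p^(n-m) turns p^-(n-i) into p^-(m-i); a term with i > m has trace 0. *)
Lemma Ttilde_trace m : (m <= n)%N ->
  Ttilde_ m = \sum_(l < p ^ (n - m)) sigma (1 + p ^ m.+1 * l) (Ttilde n zeta).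
Proof.
move=> mn; have nd l : ~~ (p %| (1 + p ^ m.+1 * l))%N.
  by rewrite dvdn_addl ?expnS -?mulnA ?dvdn_mulr // dvdn1 gtn_eqF.
have -> : \sum_(l < p ^ (n - m)) sigma (1 + p ^ m.+1 * l) (Ttilde n zeta) =
    \sum_(1 <= i < n.+1) p%:R ^- (n - i) *
      \sum_(l < p ^ (n - m)) sigma (1 + p ^ m.+1 * l) (zeta_ n zeta i).
  rewrite /Ttilde; under eq_bigr do rewrite rmorph_sum /=.
  rewrite exchange_big; apply: eq_bigr => i _ /=; rewrite mulr_sumr.
  by apply: eq_bigr => l _; rewrite rmorphM fmorphV rmorphXn /= rmorph_nat.
have zE i : (i <= n)%N -> \sum_(l < p ^ (n - m)) sigma (1 + p ^ m.+1 * l) (zeta_ n zeta i) =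
    zeta_ n zeta i * \sum_(l < p ^ (n - m)) (zeta ^+ (p ^ (n - i) * p ^ m.+1)%N) ^+ l.
  move=> i_n; rewrite mulr_sumr; apply: eq_bigr => l _.
  rewrite (sigma_unity zeta_prim K_gen) ?zeta_unity //.
  by rewrite /zeta_ -!exprM mulnDr muln1 exprD mulnA.
rewrite (@big_cat_nat _ _ _ m.+1) //= ?ltnS // [X in _ + X]big_nat_cond [X in _ + X]big1 ?addr0.
  apply: eq_big_nat => i /andP[i1 im]; rewrite ltnS in im.
  rewrite zE ?(leq_trans im) //.
  have -> : zeta ^+ (p ^ (n - i) * p ^ m.+1)%N = 1.
    by apply/eqP; rewrite -(prim_order_dvd zeta_prim) -expnD dvdn_exp2l //; lia.
  under eq_bigr do rewrite expr1n.
  rewrite sumr_const card_ord natrX.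
  have -> : (n - i = (n - m) + (m - i))%N by lia.
  by rewrite exprD invfM [_ * p%:R ^+ _]mulrC mulrACA mulVf ?expf_neq0 // mul1r.
move=> i /andP[/andP[mi i_n] _]; rewrite ltnS in i_n; rewrite zE //.
set r := zeta ^+ _; have r1 : r != 1.
  rewrite /r -(prim_order_dvd zeta_prim) -expnD dvdn_Pexp2l //; lia.
have rX : r ^+ (p ^ (n - m)) = 1.
  apply/eqP; rewrite /r -exprM -(prim_order_dvd zeta_prim) -!expnD dvdn_exp2l //; lia.
have : (r - 1) * \sum_(l < p ^ (n - m)) r ^+ l = 0 by rewrite -subrX1 rX subrr.
by move/eqP; rewrite mulf_eq0 subr_eq0 (negbTE r1) => /eqP ->; rewrite !mulr0.
Qed.

(** What a monomial X^a of g contributes to the sum of the p^-j g(zeta^(p^j)). *)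
Definition twist a : K := \sum_(0 <= j < n.+1) p%:R ^- j * zeta ^+ (a * p ^ j).

(* With m = n - logn p a, T (twist a) + p^-n is a conjugate of T (Ttilde_ m): the
   terms j < m of twist a make up Ttilde_ m, and T maps the others to
   - p^-m + \sum_(m < j <= n) p^-j (p - 1) = - p^-n. *)
Lemma T_twist a : exists P c, T (twist a) + p%:R ^- n = pact gamma P t + iota c * p%:R /\
  exists z : Zp, P.[1] = (~~ (p %| a)%N)%:R + p%:R * z.
Proof.
have tele k l : (k <= l)%N ->
    \sum_(k <= j < l) p%:R ^- j.+1 * (p%:R - 1) = p%:R ^- k - p%:R ^- l :> K.
  move=> kl; rewrite -[RHS]opprB -(telescope_sumr (fun j => p%:R ^- j) kl) -sumrN.
  apply: eq_big_nat => j _; rewrite mulrBr mulr1 exprS invfM mulrAC mulVf // mul1r.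
  by rewrite opprB.
(* If [D] divides a, all the roots of unity involved are 1, and the sum of the p^-j (p - 1)
   telescopes to p - p^-n: only the generator p contributes. *)
have [pa|npa] := boolP (D %| a)%N.
  exists 0, 1; rewrite pact0 add0r rmorph1 mul1r; split; last first.
    exists 0; rewrite horner0 mulr0 addr0 (dvdn_trans _ pa) //.
    by rewrite expnS dvdn_mulr.
  rewrite /twist raddf_sum /= big_nat_recl // (eq_bigr (fun j => p%:R ^- j.+1 * (p%:R - 1))).
    rewrite tele // expr0 invr1 !mul1r addrA subrK.
    have -> : zeta ^+ (a * p ^ 0) = 1 by apply/eqP; rewrite muln1 -(prim_order_dvd zeta_prim).
    by rewrite T1 // subrK.
  move=> j _; rewrite T_pXV.
  have -> : zeta ^+ (a * p ^ j.+1) = 1.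
    by apply/eqP; rewrite -(prim_order_dvd zeta_prim) dvdn_mulr.
  by rewrite T1.
have a_gt0 : (0 < a)%N by case: a npa => //; rewrite dvdn0.
have [b co_b ab] := pfactor_coprime p_pr a_gt0; set k := logn p a in ab.
have pb : ~~ (p %| b)%N by rewrite -prime_coprime.
have kn : (k <= n)%N by rewrite leqNgt; apply: contra npa => nk; rewrite pfactor_dvdn.
pose m := (n - k)%N; have mn : (m <= n)%N by rewrite leq_subr.
have low : \sum_(0 <= j < m) p%:R ^- j * zeta ^+ (a * p ^ j) = sigma b (Ttilde_ m).
  rewrite /Ttilde_ big_add1 /= big_nat_rev rmorph_sum; apply: eq_big_nat => j /andP[_ jm] /=.
  rewrite rmorphM fmorphV rmorphXn /= rmorph_nat (sigma_unity zeta_prim K_gen) ?zeta_unity //.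
  rewrite add0n /zeta_ -exprM; congr (_ * _ ^+ _).
  have -> : (n - j.+1 = k + (m - j.+1))%N by rewrite /m in jm *; lia.
  by rewrite ab expnD -mulnA mulnC.
have mid : T (zeta ^+ (a * p ^ m)) = -1.
  have an : (a * p ^ m = b * p ^ n)%N by rewrite ab -mulnA -expnD subnKC.
  rewrite T_unity // an -?exprM -?mulnA -?expnSr; last first.
    by rewrite mulnC exprM (prim_expr_order zeta_prim) expr1n.
  rewrite -(prim_order_dvd zeta_prim) expnS dvdn_pmul2r ?expn_gt0 ?p_gt0 //.
  by rewrite (negbTE pb).
have high : T (\sum_(m.+1 <= j < n.+1) p%:R ^- j * zeta ^+ (a * p ^ j)) = p%:R ^- m - p%:R ^- n.
  rewrite raddf_sum /= big_add1 /= -tele //; apply: eq_big_nat => j /andP[mj _]; rewrite T_pXV.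
  have -> : zeta ^+ (a * p ^ j.+1) = 1.
    apply/eqP; rewrite -(prim_order_dvd zeta_prim) ab -mulnA -expnD dvdn_mull //.
    by apply: dvdn_exp2l; move: mj; rewrite /m; lia.
  by rewrite T1.
have nd l : ~~ (p %| (1 + p ^ m.+1 * l))%N.
  by rewrite dvdn_addl ?expnS -?mulnA ?dvdn_mulr // dvdn1 gtn_eqF.
have /choice[e eP] (l : nat) : exists e, forall x,
    T (sigma ((1 + p ^ m.+1 * l) * b) x) = (gamma ^+ e)%g (T x).
  by apply: (T_sigma p_odd zeta_prim K_gen); rewrite Euclid_dvdM // negb_or nd.
(* A sum of p^k monomials, with k = [logn p a]: its augmentation p^k is 1 if p does not divide a,
   and 0 modulo p otherwise. *)
exists (\sum_(l < p ^ k) 'X^(e l)), 0; split.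
  rewrite rmorph0 mul0r addr0 pact_sum.
  rewrite /twist (@big_cat_nat _ _ _ m) //= 1?ltnW // raddfD /= low.
  rewrite big_ltn ?ltnS // raddfD /= high T_pXV mid.
  rewrite mulrN1 addKr subrK Ttilde_trace // /m subKn // rmorph_sum raddf_sum /=.
  apply: eq_bigr => l _; rewrite pactXn -eP.
  by rewrite (sigmaM zeta_prim K_gen) ?nd // galMx.
rewrite horner_sum; under eq_bigr do rewrite hornerXn expr1n.
rewrite sumr_const card_ord; case: (posnP k) => [k0|k_gt0].
  by exists 0; rewrite k0 mulr0 addr0 ab k0 muln1 pb.
exists (p ^ k.-1)%:R; rewrite -natrM -expnS prednK //.
by rewrite ab -(prednK k_gt0) expnS dvdn_mull ?dvdn_mulr // add0r.
Qed.

End CyclicModule.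

(** * The Frobenius congruence for polynomials over Z_p *)

Section FrobeniusPoly.
Variables (p : nat) (p_pr : prime p) (p_odd : odd p).
Local Notation Zp := (padic_int p_pr).
Implicit Types f g : {poly Zp}.

Lemma padic_fermat (a : Zp) : exists b, a ^+ p = a + p%:R * b.
Proof.
have [r [y ->]] := padic_digit a.
have [z ez] := exprD_prime p_pr (r%:R : Zp) (p%:R * y).
have [w ew] : exists w : Zp, (r ^ p)%:R = r%:R + p%:R * w.
  have /(padic_natmodP p_pr 0 _ _)[w ->] : (r ^ p)%N = r %[mod p ^ 1].
    by rewrite expn1 fermat_little.
  by exists w.
have pX m : (0 < m)%N -> (p%:R * y) ^+ m = p%:R * (y * (p%:R * y) ^+ m.-1).
  by case: m => // m _; rewrite exprS mulrA.
rewrite ez -natrX ew pX ?prime_gt0 //; move: (_ ^+ p.-1) (r%:R ^+ p.-1) => u v.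
by exists (w + y * u + (v * (p%:R * y) + (p%:R * y) ^+ 2 * z) - y); ring.
Qed.

Lemma frobenius_poly f : exists r, f ^+ p = f \Po 'X^p + p%:R * r.
Proof.
elim/poly_ind: f => [|f a [r IHf]].
  by exists 0; rewrite comp_poly0 expr0n gtn_eqF ?prime_gt0 // mulr0 addr0.
have [z ->] := exprD_prime p_pr (f * 'X) a%:P.
have [b ab] := padic_fermat a.
rewrite comp_polyD comp_polyM comp_polyX comp_polyC exprMn IHf -polyC_exp ab polyCD polyCM.
rewrite polyC_natr; move: (f \Po _) (_ ^+ p.-1) => u v.
by exists (r * 'X^p + b%:P + (v * a%:P + a%:P ^+ 2 * z)); ring.
Qed.

Lemma frobenius_polyX f k : exists r, f ^+ (p ^ k) = f \Po 'X^(p ^ k) + p%:R * r.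
Proof.
elim: k => [|k [r IHk]]; first by exists 0; rewrite expr1 comp_polyXr mulr0 addr0.
have [s es] := frobenius_poly (f \Po 'X^(p ^ k)).
have [z ez] := exprD_lift1 p_pr p_odd 0 (f \Po 'X^(p ^ k)) r.
rewrite expnSr exprM IHk -[p%:R]expr1 ez es -comp_polyA comp_Xn_poly -exprM mulnC.
by exists (s + p%:R * z); ring.
Qed.

End FrobeniusPoly.

(** * The logarithm as a limit of p-power quotients, and Dwork's congruence *)

Section Logarithm.
Variables (p : nat) (p_pr : prime p) (p_odd : odd p).
Variables (K : splittingFieldType (padic_field p_pr)).
Variables (n : nat) (zeta : K) (zeta_prim : (p ^ n.+1).-primitive_root zeta).
Hypothesis K_gen : <<1; zeta>>%VS = {:K}%VS.
Local Notation Zp := (padic_int p_pr).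
Local Notation iota := (@Zp_to_ext p p_pr K).
Local Notation D := (p ^ n.+1)%N.
Local Notation Oint := (@Oint p p_pr K).
Local Notation Opow := (@Opow p p_pr K).
Local Notation galK := (gal_of {:K}).
Implicit Types (x y z u v : K) (f g : {poly Zp}).

Let pK0 := pK_neq0 K.
Let pX0 k : (p%:R : K) ^+ k != 0 := expf_neq0 k pK0.

Lemma cvg_unique s x y : padic_cvg s x -> padic_cvg s y -> x = y.
Proof.
move=> /padic_cvgP sx /padic_cvgP sy; apply/eqP; rewrite -subr_eq0; apply/eqP.
apply: (Opow_sep zeta_prim K_gen) => N; have [M sM] := sx N; have [M' sM'] := sy N.
have := rpredB (sM' _ (leq_maxr M M')) (sM _ (leq_maxl M M')).
by rewrite opprB addrC addrA subrK.
Qed.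

Lemma cvg_cst x : padic_cvg (fun=> x) x.
Proof. by apply/padic_cvgP => N; exists 0%N => m _; rewrite subrr rpred0. Qed.

Lemma cvgD s t x y : padic_cvg s x -> padic_cvg t y -> padic_cvg (fun m => s m + t m) (x + y).
Proof.
move=> /padic_cvgP sx /padic_cvgP ty; apply/padic_cvgP => N.
have [M sM] := sx N; have [M' tM] := ty N; exists (maxn M M') => m.
by rewrite geq_max => /andP[/sM ? /tM ?]; rewrite opprD addrACA rpredD.
Qed.

Lemma cvg_divp s x : padic_cvg s x -> padic_cvg (fun m => p%:R^-1 * s m) (p%:R^-1 * x).
Proof.
move=> /padic_cvgP sx; apply/padic_cvgP => N; have [M sM] := sx N.+1.
by exists M => m /sM; rewrite -mulrBr -[_ - x](mulVKf pK0) Opow_mulp mulVKf.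
Qed.

Lemma cvg_shift s x : padic_cvg (fun m => s m.+1) x <-> padic_cvg s x.
Proof.
split=> /padic_cvgP sx; apply/padic_cvgP => N; have [M sM] := sx N.
  by exists M.+1 => -[//|m] /sM.
by exists M => m Mm; apply/sM/leqW.
Qed.

Lemma cvg_Opow N s x : (forall m, s m \in Opow N) -> padic_cvg s x -> x \in Opow N.
Proof.
move=> sN /padic_cvgP/(_ N)[M sM]; rewrite -[x](subKr (s M)).
by apply: rpredB; [apply: sN|apply: sM].
Qed.

Lemma cvg_ext s t x : s =1 t -> padic_cvg s x -> padic_cvg t x.
Proof. by move=> /funext ->. Qed.

Definition ell m u : K := p%:R ^- m * (u ^+ (p ^ m) - 1).

Lemma ellM m u v : ell m (u * v) = ell m u + ell m v + p%:R ^+ m * ell m u * ell m v.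
Proof.
rewrite /ell exprMn; move: (u ^+ _) (v ^+ _) (p%:R ^+ m) (pX0 m) => a b P P0.
by field.
Qed.

(** The error p^m [ell m u] [ell m v] in [ellM] tends to 0 because convergent sequences have bounded
    denominators. *)
Lemma cvg_ellM u v x y : padic_cvg (ell^~ u) x -> padic_cvg (ell^~ v) y ->
  padic_cvg (ell^~ (u * v)) (x + y).
Proof.
move=> ux vy; have uvxy := cvgD ux vy.
have bound w z : padic_cvg (ell^~ w) z -> exists c M, forall m, (M <= m)%N -> p%:R ^+ c * ell m w \in Oint.
  move=> /padic_cvgP/(_ 0%N)[M wM]; have [c /(Rz_Oint zeta_prim) Oz] := denominator K_gen z.
  exists c, M => m /wM; rewrite Opow0 => Owz.
  by rewrite -[ell m w](subrK z) mulrDr rpredD // rpredM ?rpredX ?rpred_nat.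
have [c [M cM]] := bound _ _ ux; have [c' [M' cM']] := bound _ _ vy.
rewrite -[x + y]addr0; apply: cvg_ext (fun m => esym (ellM m u v)) _.
apply: cvgD uvxy _; apply/padic_cvgP => N; exists (maxn (maxn M M') (N + c + c')) => m.
rewrite !geq_max subr0 => /andP[/andP[/cM Ou /cM' Ov]] Nm.
have -> : p%:R ^+ m = p%:R ^+ N * p%:R ^+ c * p%:R ^+ c' * p%:R ^+ (m - (N + c + c')) :> K.
  by rewrite -!exprD subnKC.
have -> : p%:R ^+ N * p%:R ^+ c * p%:R ^+ c' * p%:R ^+ (m - (N + c + c')) * ell m u * ell m v =
  p%:R ^+ N * (p%:R ^+ (m - (N + c + c')) * ((p%:R ^+ c * ell m u) * (p%:R ^+ c' * ell m v))) by ring.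
by rewrite Opow_p; apply: rpredM; [rewrite rpredX ?rpred_nat|apply: rpredM].
Qed.

Lemma cvg_gal (s : galK) w x : padic_cvg w x -> padic_cvg (s \o w) (s x).
Proof.
move=> /padic_cvgP wx; apply/padic_cvgP => N; have [M wM] := wx N.
by exists M => m /wM /(gal_Opow s); rewrite rmorphB.
Qed.

Lemma ell_gal (s : galK) m u : ell m (s u) = s (ell m u).
Proof. by rewrite /ell rmorphM fmorphV rmorphB rmorph1 /= !rmorphXn /= rmorph_nat. Qed.

(** The p^m-th powers agree modulo p^(m+k+1), and dividing by p^m leaves p^(k+1). The bound is
    uniform in m, so it passes to the limit. *)
Lemma ell_cong k m u v : u \in Oint -> v \in Oint -> u - v \in Opow k.+1 ->
  ell m u - ell m v \in Opow k.+1.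
Proof.
rewrite !(Oint_Rz zeta_prim K_gen) => /RzP[f ->] /RzP[g ->] /OpowP[w].
rewrite (Oint_Rz zeta_prim K_gen) => /RzP[h ->] fg.
have [r er] := expr_pX_lift (p := p) p_pr p_odd k m g h.
have -> : peval zeta f = peval zeta (g + p%:R ^+ k.+1 * h).
  by rewrite rmorphD rmorphM rmorphXn /= rmorph_nat -fg addrC subrK.
have {}er : peval zeta (g + p%:R ^+ k.+1 * h) ^+ (p ^ m) =
    peval zeta g ^+ (p ^ m) + p%:R ^+ (m + k.+1) * peval zeta r.
  by rewrite -rmorphXn er rmorphD rmorphM !rmorphXn /= rmorph_nat addnS [(m + k)%N]addnC.
rewrite /ell er -mulrBr opprB addrA subrK addrAC subrr add0r exprD -mulrA mulKf //.
by rewrite Opow_p peval_Oint ?(zeta_Oint zeta_prim).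
Qed.

(** A series summed in Z_p[X] / (X^D - 1): exponents are reduced modulo [D] to bound the degrees,
    then coefficients are summed one by one. The remainder s is independent of z. *)
Lemma poly_series (r : nat -> {poly Zp}) : exists g, forall m, exists s, forall z, z ^+ D = 1 ->
  peval z g = \sum_(k < m) p%:R ^+ k * peval z (r k) + p%:R ^+ m * peval z s.
Proof.
have D_gt0 := D_gt0 p_pr n.
pose red f : {poly Zp} := \sum_(i < size f) f`_i *: 'X^(i %% D).
have redE z f : z ^+ D = 1 -> peval z (red f) = peval z f.
  move=> zD; rewrite /red rmorph_sum pevalE; apply: eq_bigr => i _ /=.
  by rewrite pevalZ rmorphXn /= pevalX expr_mod.
have red_size f : (size (red f) <= D)%N.
  apply: (leq_trans (size_sum _ _ _)); apply/bigmax_leqP => i _.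
  by apply: (leq_trans (size_scale_leq _ _)); rewrite size_polyXn ltn_mod.
have /choice[l lP] (i : nat) := padic_series (fun k => (red (r k))`_i).
have /choice[y yP] (m : nat) : exists y : nat -> Zp, forall i,
    l i = \sum_(k < m) p%:R ^+ k * (red (r k))`_i + p%:R ^+ m * y i.
  by have /choice[y yP] (i : nat) := lP i m; exists y.
exists (\poly_(i < D) l i) => m; exists (\poly_(i < D) y m i) => z zD.
have -> : \poly_(i < D) l i = \sum_(k < m) p%:R ^+ k * red (r k) + p%:R ^+ m * \poly_(i < D) y m i.
  apply/polyP => i; rewrite coefD coef_poly coef_sum.
  have pXE k : p%:R ^+ k = (p%:R ^+ k)%:P :> {poly Zp} by rewrite polyC_exp polyC_natr.
  under eq_bigr do rewrite pXE coefCM.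
  rewrite pXE coefCM coef_poly; case: ltnP => [_|Di]; first exact: yP.
  rewrite mulr0 addr0 big1 // => k _; rewrite nth_default ?mulr0 //.
  exact: leq_trans (red_size _) Di.
rewrite rmorphD rmorph_sum rmorphM rmorphXn /= rmorph_nat; congr (_ + _).
by apply: eq_bigr => k _; rewrite rmorphM rmorphXn /= rmorph_nat redE.
Qed.

Lemma ell1 m : ell m 1 = 0. Proof. by rewrite /ell expr1n subrr mulr0. Qed.

Lemma peval1 f : peval (1 : K) f = iota f.[1].
Proof. by rewrite -(rmorph1 iota) peval_iota. Qed.

(* Dwork's lemma: (1 - phi/p) log f is integral, where phi f = f(X^p), here
   evaluated at the p^(n+1)-th roots of unity. *)
Lemma dwork f : f.[1] = 1 -> exists g, g.[1] = 0 /\ forall z, z ^+ D = 1 ->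
  padic_cvg (fun m => ell m.+1 (peval z f) - p%:R^-1 * ell m (peval (z ^+ p) f)) (peval z g).
Proof.
move=> f1; pose phi := f \Po 'X^p.
(* [G m] is the quotient of f^(p^(m+1)) - phi^(p^m) by p^(m+1); its value at z is the m-th term of
   the sequence to be studied. *)
have /choice[G GP] (m : nat) : exists G, f ^+ (p ^ m.+1) = phi ^+ (p ^ m) + p%:R ^+ m.+1 * G.
  have [r er] := frobenius_poly f.
  have [z ez] := expr_pX_lift p_pr p_odd 0 m phi r.
  by exists z; rewrite expnS exprM er -[p%:R]expr1 ez.
have pPX0 k : p%:R ^+ k != 0 :> {poly Zp}.
  by rewrite expf_neq0 // -polyC_natr polyC_eq0 padic_p_neq0.
have Grec (m : nat) : exists z : {poly Zp}, G m.+1 = phi ^+ (p ^ m) ^+ p.-1 * G m + p%:R ^+ m.+1 * z.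
  have [z ez] := exprD_lift p_pr p_odd m (phi ^+ (p ^ m)) (G m).
  exists z; apply: (mulfI (pPX0 m.+2)); apply: (addrI (phi ^+ (p ^ m.+1))).
  by rewrite -GP (expnSr p m.+1) exprM GP ez -(exprM phi _ p) -expnSr.
(* B takes the value 1 at every z with z^D = 1, and phi^D is B modulo p. Hence phi^(p^(n+1+m)) is 1
   modulo p^(m+1) there, and from index n+1 on the recursion [Grec] makes the values of G a Cauchy
   sequence. *)
pose B := f \Po 'X^(p * D).
have [r0 er0] : exists r, phi ^+ D = B + p%:R ^+ 1 * r.
  have [r ->] := frobenius_polyX p_odd phi n.+1; exists r.
  by rewrite /B /phi -comp_polyA comp_Xn_poly -exprM expr1 mulnC.
have /choice[r rP] (m : nat) : exists r, forall z, z ^+ D = 1 ->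
    peval z (G (n.+1 + m).+1) = peval z (G (n.+1 + m)%N) + p%:R ^+ m.+1 * peval z r.
  have [y ey] := Grec (n.+1 + m)%N.
  have [w ew] := expr_pX_lift p_pr p_odd 0 m B r0.
  have [v ev] := exprDn2 (B ^+ (p ^ m)) (p%:R ^+ m.+1 * w) p.-1.
  exists (w * ((p.-1)%:R * (B ^+ (p ^ m)) ^+ p.-1.-1 + p%:R ^+ m.+1 * w * v) * G (n.+1 + m)%N
    + p%:R ^+ n.+1 * y) => z zD.
  have Bz : peval z B = 1.
    by rewrite /B peval_comp mulnC exprM zD expr1n peval1 f1 rmorph1.
  rewrite ey expnD exprM er0 ew ev.
  transitivity (peval z ((B ^+ (p ^ m)) ^+ p.-1 * G (n.+1 + m)%N) + p%:R ^+ m.+1 *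
    peval z (w * ((p.-1)%:R * (B ^+ (p ^ m)) ^+ p.-1.-1 + p%:R ^+ m.+1 * w * v) * G (n.+1 + m)%N
    + p%:R ^+ n.+1 * y)).
    have -> : p%:R ^+ m.+1 = peval z (p%:R ^+ m.+1) by rewrite rmorphXn /= rmorph_nat.
    rewrite -rmorphM -rmorphD; congr (peval z _).
    rewrite -addnS exprD; ring.
  by rewrite rmorphM !rmorphXn /= Bz !expr1n mul1r.
have [g' g'P] := poly_series r.
pose g := G n.+1 + p%:R * g'.
have limG z : z ^+ D = 1 -> padic_cvg (fun m => peval z (G m)) (peval z g).
  move=> zD; apply/padic_cvgP => N; exists (n.+1 + N)%N => m /subnKC <-.
  rewrite -addnA; move: (m - _)%N => l.
  have GE k : peval z (G (n.+1 + k)%N) = peval z (G n.+1) + p%:R * \sum_(i < k) p%:R ^+ i * peval z (r i).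
    elim: k => [|k IHk]; first by rewrite addn0 big_ord0 mulr0 addr0.
    by rewrite addnS rP // IHk big_ord_recr /= mulrDr exprS mulrA addrA.
  have [s sP] := g'P (N + l)%N.
  rewrite GE /g rmorphD rmorphM /= rmorph_nat sP //.
  rewrite exprD; set S := \sum_(i < _) _; set A := peval z (G n.+1); set q : K := p%:R.
  have -> : A + q * S - (A + q * (S + q ^+ N * q ^+ l * peval z s)) =
      q ^+ N * (- (q * q ^+ l * peval z s)) by ring.
  by rewrite Opow_p rpredN !rpredM ?rpredX ?rpred_nat ?peval_Oint ?(unity_Oint _ zD) ?D_gt0.
have gE z : z ^+ D = 1 ->
    padic_cvg (fun m => ell m.+1 (peval z f) - p%:R^-1 * ell m (peval (z ^+ p) f)) (peval z g).
  move=> zD; apply: cvg_ext (limG z zD) => m.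
  have fE : peval z f ^+ (p ^ m.+1) = peval (z ^+ p) f ^+ (p ^ m) + p%:R ^+ m.+1 * peval z (G m).
    by rewrite -rmorphXn GP rmorphD rmorphM !rmorphXn /= rmorph_nat peval_comp.
  rewrite /ell fE exprS; move: (pX0 m) pK0.
  move: (p%:R : K) (p%:R ^+ m : K) (_ ^+ (p ^ m)) (peval z (G m)) => q P b c P0 q0.
  by field; apply/andP.
(* At z = 1 the sequence is identically 0, whence g(1) = 0. *)
exists g; split=> //; apply: (@Zp_to_ext_inj p p_pr K); rewrite rmorph0 -peval1.
apply: cvg_unique (gE 1 (expr1n _ _)) _; apply: cvg_ext (cvg_cst 0) => m.
by rewrite expr1n peval1 f1 rmorph1 !ell1 mulr0 subrr.
Qed.

(** Iterates log f(z) = g(z) + p^-1 log f(z^p), which stops after i steps because z^(p^i) = 1 and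
    f(1) = 1. *)
Lemma cvg_ell f g : f.[1] = 1 -> g.[1] = 0 ->
  (forall z, z ^+ D = 1 -> padic_cvg (fun m => ell m.+1 (peval z f) -
     p%:R^-1 * ell m (peval (z ^+ p) f)) (peval z g)) ->
  forall i z, (i <= n.+1)%N -> z ^+ (p ^ i) = 1 ->
  padic_cvg (ell^~ (peval z f)) (\sum_(0 <= j < i) p%:R ^- j * peval (z ^+ (p ^ j)) g).
Proof.
move=> f1 g1 gP; elim=> [|i IHi] z i_n zi.
  rewrite expr1 in zi; rewrite zi big_geq //.
  by apply: cvg_ext (cvg_cst 0) => m; rewrite peval1 f1 rmorph1 ell1.
have zD : z ^+ D = 1 by rewrite -(subnKC i_n) expnD exprM zi expr1n.
have zpi : (z ^+ p) ^+ (p ^ i) = 1 by rewrite -exprM -expnS.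
apply/cvg_shift; have := cvgD (gP z zD) (cvg_divp (IHi _ (ltnW i_n) zpi)).
rewrite big_nat_recl // expr0 invr1 mul1r expr1 mulr_sumr.
rewrite (eq_bigr (fun j => p%:R ^- j.+1 * peval (z ^+ (p ^ j.+1)) g)) => [|j _].
  by apply: cvg_ext => m; rewrite subrK.
by rewrite mulrA -invfM -exprS -exprM -expnS.
Qed.

End Logarithm.

(** * Agreement of the limit with the logarithm series *)

Section LogarithmSeries.
Variables (p : nat) (p_pr : prime p).
Variables (K : splittingFieldType (padic_field p_pr)).
Variables (n : nat) (zeta : K) (zeta_prim : (p ^ n.+1).-primitive_root zeta).
Hypothesis K_gen : <<1; zeta>>%VS = {:K}%VS.
Local Notation Zp := (padic_int p_pr).
Local Notation iota := (@Zp_to_ext p p_pr K).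
Local Notation D := (p ^ n.+1)%N.
Local Notation Oint := (@Oint p p_pr K).
Local Notation Opow := (@Opow p p_pr K).
Local Notation ell := (@ell p p_pr K).
Local Notation pi := (zeta - 1).
Implicit Types (x y z u v : K).

Let pK0 := pK_neq0 K.
Let p_gt1 := prime_gt1 p_pr.
Let pX0 k : (p%:R : K) ^+ k != 0 := expf_neq0 k pK0.

Lemma exp2_lower_bound (v : nat) : (v.+1 ^ 2 <= 4 * 2 ^ v)%N.
Proof.
case: v => [|[|v]] //; elim: v => [//|v IHv].
have -> : (4 * 2 ^ v.+3 = 2 * (4 * 2 ^ v.+2))%N by rewrite (expnS 2 v.+2); lia.
by apply: (leq_trans _ (leq_mul (leqnn 2) IHv)); nia.
Qed.

(** Applied with d = [totient D] and p^v dividing k: pi^k gains a factor p every d steps while 1/k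
    loses p^v. The quadratic bound (v+1)^2 <= 4 2^v makes d v negligible against k. *)
Lemma log_growth d N : exists k0, forall k v : nat, (k0 <= k)%N -> (2 ^ v <= k)%N -> (d * (v + N) <= k)%N.
Proof.
exists (8 * d * d + 2 * d * N)%N => k v k0 vk.
have := leq_trans (exp2_lower_bound v) (leq_mul (leqnn 4) vk).
by case: (leqP (8 * d) v.+1) => dv; nia.
Qed.

Lemma natV_Oint k : (0 < k)%N -> exists2 e, (p ^ e <= k)%N & p%:R ^+ e * k%:R^-1 \in Oint.
Proof.
move=> k0; have [b co_b kb] := pfactor_coprime p_pr k0.
have ub : (b%:R : Zp) \is a GRing.unit by rewrite padic_nat_unit -prime_coprime.
exists (logn p k); first exact: dvdn_leq (pfactor_dvdnn p k).
have -> : k%:R = p%:R ^+ logn p k * iota b%:R by rewrite rmorph_nat {1}kb natrM natrX mulrC.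
by have := Oint_iota K b%:R^-1; rewrite rmorphV //= invfM mulVKf ?expf_neq0.
Qed.

Lemma pi_Opow : pi ^+ totient D \in Opow 1.
Proof.
have [w Rw ->] := pi_pow_mulp zeta_prim.
by rewrite -[p%:R]expr1 Opow_p (Rz_Oint zeta_prim).
Qed.

Lemma log_term_small x N : x \in Oint ->
  exists k0, forall k, (k0 < k)%N -> (pi * x) ^+ k / k%:R \in Opow N.
Proof.
move=> Ox; have [k0 k0P] := log_growth (totient D) N.
exists k0 => k kk0; have k_gt0 : (0 < k)%N by case: k kk0.
have [e ek Ok] := natV_Oint k_gt0.
have dk : (totient D * (e + N) <= k)%N.
  apply: k0P; first exact: ltnW.
  by apply: leq_trans ek; case: (e) => // e'; rewrite leq_exp2r.
have Opi : pi * x \in Oint by rewrite rpredM ?rpredB ?rpred1 ?(zeta_Oint zeta_prim).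
have piX j : pi ^+ (totient D * j) \in Opow j.
  elim: j => [|j IHj]; first by rewrite muln0 Opow0 rpred1.
  by rewrite mulnS exprD -[j.+1]add1n OpowM ?pi_Opow.
have /OpowP[w Ow ew] : (pi * x) ^+ k \in Opow (e + N).
  rewrite -(subnKC dk) exprD exprMn -mulrA mulrC OpowMl ?piX //.
  by rewrite rpredM ?rpredX.
have -> : (pi * x) ^+ k / k%:R = p%:R ^+ N * (w * (p%:R ^+ e / k%:R)).
  by rewrite ew exprD; ring.
by rewrite Opow_p rpredM.
Qed.

Lemma prod_sub_fact (R : comNzRingType) (q : R) m :
  exists z : R, \prod_(i < m) (q - i.+1%:R) = (-1) ^+ m * (m`!)%:R + q * z.
Proof.
elim: m => [|m [z IHm]]; first by exists 0; rewrite big_ord0 mulr0 addr0 mulr1.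
exists ((-1) ^+ m * (m`!)%:R + q * z - m.+1%:R * z).
by rewrite big_ord_recr /= IHm factS natrM exprS; ring.
Qed.

(** The factor m! turns the binomial coefficient into a falling factorial, whose factors q - i are
    -i modulo q. *)
Lemma bin_pred_fact (R : comNzRingType) m q : (m < q)%N ->
  exists z : R, 'C(q.-1, m)%:R * (m`!)%:R = (-1) ^+ m * (m`!)%:R + q%:R * z.
Proof.
move=> mq; have [z ez] := prod_sub_fact (q%:R : R) m; exists z; rewrite -ez.
rewrite -natrM bin_ffact ffact_prod natr_prod; apply: eq_bigr => i _.
have im : (i < q)%N by apply: ltn_trans mq.
by rewrite -natrB // -subn1 -subnDA add1n.
Qed.

(** By k C(q, k) = q C(q-1, k-1) with q = p^m, the division by p^m leaves integer coefficients next
    to the 1/k of the logarithm. *)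
Lemma ell_binomial m x :
  ell m (1 + x) = \sum_(1 <= k < (p ^ m).+1) 'C((p ^ m).-1, k.-1)%:R * (x ^+ k / k%:R).
Proof.
rewrite /ell [1 + x]addrC exprD1n big_ord_recl bin0 expr0 mulr1n addrC addKr.
rewrite big_add1 big_mkord mulr_sumr; apply: eq_bigr => k _ /=.
have pm0 : (p ^ m)%:R != 0 :> K by rewrite natrX.
have k0 : k.+1%:R != 0 :> K by apply: natK_neq0.
have := mul_bin_diag (p ^ m) k.
move/(congr1 (fun i : nat => i%:R : K)); rewrite !natrM /bump /= add1n => e.
rewrite -[_ *+ 'C(_, _)]mulr_natl -natrX.
apply: (mulfI pm0); rewrite mulVKf // [RHS]mulrA e.
by move: k0; move: (k.+1%:R : K) (_ ^+ _) => a y a0; field.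
Qed.

Lemma fact_bounded M : exists e, forall k, (k <= M)%N -> p%:R ^+ e / (k`!)%:R \in Oint.
Proof.
elim: M => [|M [e IHM]].
  by exists 0%N => k; rewrite leqn0 => /eqP ->; rewrite mul1r invr1 rpred1.
have [e' _ Oe'] := natV_Oint (fact_gt0 M.+1).
exists (e' + e)%N => k; rewrite leq_eqVlt => /predU1P[->|/IHM Ok].
  by rewrite exprD mulrAC rpredM ?rpredX ?rpred_nat.
by rewrite exprD -mulrA rpredM ?rpredX ?rpred_nat.
Qed.

(* The coefficient p^-m 'C(p^m, k) of x^k in ell m (1 + x) tends to (-1)^(k-1) / k,
   and the terms of high degree are uniformly small. *)
Lemma padic_log_ell x l : x \in Oint ->
  padic_cvg (ell^~ (1 + pi * x)) l -> padic_log (1 + pi * x) = l.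
Proof.
move=> Ox /padic_cvgP ul; set u := 1 + pi * x.
have Opi : pi * x \in Oint by rewrite rpredM ?rpredB ?rpred1 ?(zeta_Oint zeta_prim).
suff cv : padic_cvg (log_partial_sum u) l.
  rewrite /padic_log; case: xgetP => [l' _ cv'|/(_ l)/(_ cv)//].
  exact: (cvg_unique zeta_prim K_gen cv' cv).
apply/padic_cvgP => N; have [k0 k0P] := log_term_small N Ox.
exists k0 => M k0M; have [e eP] := fact_bounded M; have [m0 m0P] := ul N.
(* m >= m0 brings [ell m u] within p^N of l, m >= N + e absorbs the denominators k! for k <= M, and
   m > M gives M < p^m, so that the binomial sum covers the partial sum. *)
pose m := (maxn m0 (N + e + M.+1))%N.
have m0m : (m0 <= m)%N by rewrite leq_maxl.
have Nem : (N + e <= m)%N by rewrite (leq_trans _ (leq_maxr _ _)) // leq_addr.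
have Mm : (M < p ^ m)%N.
  apply: (@leq_ltn_trans m); last exact: ltn_expl.
  by rewrite (leq_trans _ (leq_maxr _ _)) // addnS leqW // leq_addl.
rewrite -[log_partial_sum u M](subrK (ell m u)) -addrA rpredD ?m0P //.
rewrite -opprB rpredN /u ell_binomial /log_partial_sum.
have Mm' : (M.+1 <= (p ^ m).+1)%N := leqW Mm.
rewrite (@big_cat_nat _ _ _ M.+1) //= addrAC rpredD //.
  rewrite -sumrB big_nat; apply: rpred_sum => k /andP[k1 kM]; rewrite ltnS in kM.
  have k1M : (k.-1 < p ^ m)%N by rewrite prednK // ltnW // (leq_ltn_trans kM).
  have [z /(congr1 iota)] := @bin_pred_fact Zp _ _ k1M.
  rewrite rmorphD !rmorphM rmorphXn rmorphN rmorph1 /= !rmorph_nat natrX => ez.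
  have -> : 1 + pi * x - 1 = pi * x by rewrite addrAC subrr add0r.
  have kf : (k`!)%:R = k%:R * (k.-1`!)%:R :> K by rewrite -natrM -{1 2}(prednK k1) -factS.
  have k0' : k%:R != 0 :> K by apply: natK_neq0.
  have f0 : (k.-1`!)%:R != 0 :> K by apply/natK_neq0/fact_gt0.
  have -> : (-1) ^+ k.+1 = (-1) ^+ k.-1 :> K by rewrite -{1}(prednK k1) !exprS; ring.
  have -> : 'C((p ^ m).-1, k.-1)%:R * ((pi * x) ^+ k / k%:R) - (-1) ^+ k.-1 * (pi * x) ^+ k / k%:R =
      p%:R ^+ (m - e) * (iota z * (pi * x) ^+ k * (p%:R ^+ e / (k`!)%:R)).
    have -> : p%:R ^+ (m - e) * (iota z * (pi * x) ^+ k * (p%:R ^+ e / (k`!)%:R)) =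
        p%:R ^+ m * iota z * (pi * x) ^+ k / (k`!)%:R.
      have em : (e <= m)%N by rewrite (leq_trans _ Nem) // leq_addl.
      by rewrite -{2}(subnK em) exprD; ring.
    have -> : p%:R ^+ m * iota z = ('C((p ^ m).-1, k.-1)%:R - (-1) ^+ k.-1) * (k.-1`!)%:R.
      by rewrite mulrBl ez addrAC subrr add0r.
    rewrite kf; move: ((-1) ^+ _) (_ ^+ k) k0' f0 => s y.
    move: (k%:R : K) ((k.-1)`!%:R : K) => a b a0 b0.
    by field; rewrite b0.
  apply: (@OpowW _ _ _ N (m - e)); first by lia.
  rewrite Opow_p; apply: rpredM; last exact: eP.
  by apply: rpredM; [apply: Oint_iota|apply: rpredX].
rewrite big_nat; apply: rpred_sum => k /andP[Mk _].
by apply: OpowMl; [apply: rpred_nat|apply/k0P/(leq_ltn_trans k0M)].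
Qed.

End LogarithmSeries.

(** * The image of T log on principal units *)

Section Image.
Variables (p : nat) (p_pr : prime p) (p_odd : odd p).
Variables (K : splittingFieldType (padic_field p_pr)).
Variables (n : nat) (zeta : K) (zeta_prim : (p ^ n.+1).-primitive_root zeta).
Hypothesis K_gen : <<1; zeta>>%VS = {:K}%VS.
Local Notation Zp := (padic_int p_pr).
Local Notation iota := (@Zp_to_ext p p_pr K).
Local Notation D := (p ^ n.+1)%N.
Local Notation Oint := (@Oint p p_pr K).
Local Notation Opow := (@Opow p p_pr K).
Local Notation ell := (@ell p p_pr K).
Local Notation galK := (gal_of {:K}).
Local Notation T := (T_Delta n zeta).
Local Notation gamma := (gamma zeta).
Local Notation t := (T_Delta n zeta (Ttilde n zeta)).
Local Notation units1 := (units1 zeta).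
Local Notation log := (@padic_log p p_pr K).
Implicit Types (x y z u v : K) (f g P Q : {poly Zp}).

Let pK0 := pK_neq0 K.
Let p_gt1 := prime_gt1 p_pr.
Let p_gt0 := prime_gt0 p_pr.
Let gal_comm := galC zeta_prim K_gen.

Lemma units1P u : units1 u <-> exists2 f, f.[1] = 1 & u = peval zeta f.
Proof.
split=> [[x /OintP Ox <-]|[f f1 ->]].
  move: Ox; rewrite (Oint_Rz zeta_prim K_gen) => /RzP[q ->].
  exists (1 + ('X - 1) * q); first by rewrite !hornerE subrr mul0r addr0.
  by rewrite rmorphD rmorphM rmorphB !rmorph1 /= pevalX.
have /factor_theorem[q fq] : root (f - 1) 1 by rewrite /root !hornerE f1 subrr.
exists (peval zeta q); first by apply/OintP/peval_Oint/(zeta_Oint zeta_prim).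
by rewrite -[f in RHS](subrK 1) fq rmorphD rmorphM rmorphB !rmorph1 /= pevalX addrC mulrC.
Qed.

Lemma log_ell f l : f.[1] = 1 -> padic_cvg (ell^~ (peval zeta f)) l -> log (peval zeta f) = l.
Proof.
move=> f1; have /units1P[x /OintP Ox <-] : exists2 g, g.[1] = 1 & peval zeta f = peval zeta g by exists f.
exact: (padic_log_ell zeta_prim K_gen).
Qed.

Lemma cvg_log u : units1 u -> padic_cvg (ell^~ u) (log u).
Proof.
move=> /units1P[f f1 ->]; have [g [g1 gP]] := dwork p_odd zeta_prim K_gen f1.
have := cvg_ell f1 g1 gP (leqnn _) (prim_expr_order zeta_prim).
by move=> cv; rewrite (log_ell f1 cv).
Qed.

Lemma units1M u v : units1 u -> units1 v -> units1 (u * v).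
Proof.
move=> /units1P[f f1 ->] /units1P[g g1 ->]; apply/units1P; exists (f * g).
  by rewrite hornerM f1 g1 mulr1.
by rewrite rmorphM.
Qed.

Lemma units1_1 : units1 1.
Proof. by apply/units1P; exists 1; rewrite ?rmorph1 ?hornerC. Qed.

Lemma units1_Oint u : units1 u -> u \in Oint.
Proof. by move=> /units1P[f _ ->]; apply/peval_Oint/(zeta_Oint zeta_prim). Qed.

Lemma units1_gal (s : galK) u : units1 u -> units1 (s u).
Proof.
move=> /units1P[f f1 ->]; rewrite gal_peval; have [a _ ->] := gal_zetaP zeta_prim s.
apply/units1P; exists (f \Po 'X^a); last by rewrite peval_comp.
by rewrite horner_comp hornerXn expr1n.
Qed.

Lemma logM u v : units1 u -> units1 v -> log (u * v) = log u + log v.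
Proof.
move=> Uu Uv; apply: (cvg_unique zeta_prim K_gen (cvg_log (units1M Uu Uv))).
by apply: (cvg_ellM zeta_prim K_gen); apply: cvg_log.
Qed.

Lemma log1 : log 1 = 0.
Proof.
apply: (cvg_unique zeta_prim K_gen (cvg_log units1_1)).
by apply: cvg_ext (cvg_cst 0) => m; rewrite ell1.
Qed.

Lemma units1X u k : units1 u -> units1 (u ^+ k).
Proof.
by move=> Uu; elim: k => [|k IHk]; [apply: units1_1|rewrite exprS; apply: units1M].
Qed.

Lemma logX u k : units1 u -> log (u ^+ k) = k%:R * log u.
Proof.
move=> Uu; elim: k => [|k IHk]; first by rewrite log1 mul0r.
by rewrite exprS logM //; [rewrite IHk -natr1 mulrDl mul1r addrC|apply: units1X].
Qed.

Lemma log_gal (s : galK) u : units1 u -> log (s u) = s (log u).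
Proof.
move=> Uu; apply: (cvg_unique zeta_prim K_gen (cvg_log (units1_gal s Uu))).
by apply: cvg_ext (cvg_gal s (cvg_log Uu)) => m /=; rewrite ell_gal.
Qed.

Lemma log_cong k u v : units1 u -> units1 v -> u - v \in Opow k.+1 -> log u - log v \in Opow k.+1.
Proof.
move=> Uu Uv uv; have := @cvg_Opow p p_pr K k.+1 (fun m => ell m u - ell m v) (log u - log v).
apply=> [m|]; first by apply: (ell_cong p_odd zeta_prim K_gen) uv; apply: units1_Oint.
move: (cvg_log Uu) (cvg_log Uv) => /padic_cvgP uP /padic_cvgP vP; apply/padic_cvgP => N.
have [M uM] := uP N; have [M' vM] := vP N; exists (maxn M M') => m.
rewrite geq_max => /andP[/uM Ou /vM Ov].
have -> : ell m u - ell m v - (log u - log v) = (ell m u - log u) - (ell m v - log v) by ring.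
exact: rpredB.
Qed.

Definition inM y := exists P (c : Zp), y = pact gamma P t + iota c * p%:R.

(* T log f(zeta) = sum_a g_a (T (twist a) + p^-n) because the sum of the
   coefficients of g is g(1) = 0; the same computation at zeta_0 determines the
   augmentation of P modulo p. *)
Lemma T_log f : f.[1] = 1 -> exists P (c : Zp),
  T (log (peval zeta f)) = pact gamma P t + iota c * p%:R /\
  exists l (z : Zp), padic_cvg (ell^~ (peval (zeta_ n zeta 0) f)) l /\
    T l = - (p%:R * iota (P.[1] + p%:R * z)).
Proof.
move=> f1; have [g [g1 gP]] := dwork p_odd zeta_prim K_gen f1.
have [P PP] := choice (T_twist p_odd zeta_prim K_gen).
have /choice[c cP] a := PP a.
have {PP}/choice[z zP] a := (cP a).2.
have g1' : \sum_(a < size g) iota g`_a = 0.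
  transitivity (iota g.[1]); last by rewrite g1 rmorph0.
  by rewrite horner_coef rmorph_sum; apply: eq_bigr => a _; rewrite expr1n mulr1.
exists (\sum_(a < size g) g`_a *: P a), (\sum_(a < size g) g`_a * c a); split.
  rewrite (log_ell f1 (cvg_ell f1 g1 gP (leqnn _) (prim_expr_order zeta_prim))).
  have -> : \sum_(0 <= j < n.+1) p%:R ^- j * peval (zeta ^+ (p ^ j)) g =
      \sum_(a < size g) iota g`_a * twist n zeta a.
    under eq_bigr do rewrite pevalE mulr_sumr; rewrite exchange_big; apply: eq_bigr => a _ /=.
    rewrite mulr_sumr; apply: eq_bigr => j _; rewrite mulrCA; congr (_ * (_ * _)).
    by rewrite -exprM mulnC.
  rewrite raddf_sum /= pact_sum rmorph_sum mulr_suml -big_split /=.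
  transitivity (\sum_(a < size g) iota g`_a * (T (twist n zeta a) + p%:R ^- n)).
    under [RHS]eq_bigr do rewrite mulrDr.
    rewrite big_split /= -mulr_suml g1' mul0r addr0; apply: eq_bigr => a _.
    by rewrite T_iota.
  by apply: eq_bigr => a _; rewrite (cP a).1 pactZ mulrDr rmorphM /= mulrA.
have w0 : zeta_ n zeta 0 ^+ p = 1.
  by rewrite /zeta_ subn0 -exprM -expnSr (prim_expr_order zeta_prim).
(* Since zeta_0^p = 1, the sum for log f(zeta_0) reduces to its term j = 0, namely g(zeta_0). *)
exists (peval (zeta_ n zeta 0) g), (- \sum_(a < size g) g`_a * z a); split.
  have := cvg_ell f1 g1 gP (i := 1) isT (z := zeta_ n zeta 0).
  by rewrite big_nat1 expr0 invr1 mul1r expr1; apply.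
have -> : (\sum_(a < size g) g`_a *: P a).[1] =
    \sum_(a < size g) g`_a * (~~ (p %| a)%N)%:R + p%:R * \sum_(a < size g) g`_a * z a.
  rewrite horner_sum mulr_sumr -big_split; apply: eq_bigr => a _ /=.
  by rewrite hornerZ zP mulrDr mulrCA.
rewrite pevalE raddf_sum /= mulrN addrK rmorph_sum mulr_sumr -sumrN.
apply/eqP; rewrite -subr_eq0 -sumrB; apply/eqP.
(* T (zeta_0^a) is p - 1, diminished by p when p does not divide a. The constant p - 1 is weighted
   by g(1) = 0. *)
transitivity (\sum_(a < size g) (p%:R - 1) * iota g`_a); last by rewrite -mulr_sumr g1' mulr0.
apply: eq_bigr => a _ /=; rewrite T_iota T_unity //; last by rewrite exprAC w0 expr1n.
rewrite /zeta_ subn0 -exprM -(prim_order_dvd zeta_prim) expnSr dvdn_pmul2l ?expn_gt0 ?p_gt0 //.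
rewrite rmorphM rmorph_nat /=; case: ifP => _; rewrite ?mulr0 ?mulr1; ring.
Qed.

Lemma inM_T_log u : units1 u -> inM (T (log u)).
Proof. by move=> /units1P[f f1 ->]; have [P [c [-> _]]] := T_log f1; exists P, c. Qed.

Lemma inM_add x y : inM x -> inM y -> inM (x + y).
Proof.
move=> [P [c ->]] [Q [d ->]]; exists (P + Q), (c + d).
by rewrite pactDp rmorphD mulrDl addrACA.
Qed.

Lemma inM_scale a x : inM x -> inM (iota a * x).
Proof.
move=> [P [c ->]]; exists (a *: P), (a * c).
by rewrite pactZ rmorphM mulrDr mulrA.
Qed.

Lemma inM_pact Q x : inM x -> inM (pact gamma Q x).
Proof.
move=> [P [c ->]]; exists (Q * P), (Q.[1] * c).
rewrite raddfD /= pactM // pact_iota rmorphM /=; congr (_ + _).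
by rewrite pact_fixed ?rmorph_nat // mulrCA mulrA.
Qed.

Lemma inM_denominator : exists c, forall y, inM y -> p%:R ^+ c * y \in Oint.
Proof.
have [c /(Rz_Oint zeta_prim) Ot] := denominator K_gen t.
exists c => y [P [d ->]]; rewrite mulrDr rpredD //.
  by rewrite -(rmorph_nat iota) -rmorphXn /= -pact_iota rmorphXn /= rmorph_nat -Opow0 pact_Opow ?Opow0.
by rewrite !rpredM ?rpredX ?rpred_nat ?Oint_iota.
Qed.

(** T log U + p M. Additivity of log gives T log U only integer multiples directly; modulo p M these
    suffice for all of Z_p, because the tail p b of a scalar r + p b falls into p M. *)
Definition inV y := exists u m, [/\ units1 u, inM m & y = T (log u) + p%:R * m].

Lemma inV_pM m : inM m -> inV (p%:R * m).
Proof.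
by move=> Mm; exists 1, m; rewrite log1 raddf0 add0r; split => //; apply: units1_1.
Qed.

Lemma inV_M y : inV y -> inM y.
Proof.
move=> [u [m [Uu Mm ->]]]; apply: inM_add; first exact: inM_T_log.
by rewrite -(rmorph_nat iota); apply: inM_scale.
Qed.

Lemma inV_add x y : inV x -> inV y -> inV (x + y).
Proof.
move=> [u [m [Uu Mm ->]]] [v [m' [Uv Mm' ->]]]; exists (u * v), (m + m').
split; [exact: units1M|exact: inM_add|].
by rewrite logM // raddfD mulrDr addrACA.
Qed.

Lemma inV_0 : inV 0.
Proof.
rewrite -(mulr0 p%:R); apply: inV_pM.
by exists 0, 0; rewrite pact0 rmorph0 mul0r addr0.
Qed.

Lemma inV_scale (a : Zp) y : inV y -> inV (iota a * y).
Proof.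
move=> Vy; have [r [b ->]] := padic_digit a.
rewrite rmorphD rmorphM !rmorph_nat /= mulrDl -mulrA; apply: inV_add; last first.
  by apply/inV_pM/inM_scale/inV_M.
elim: r => [|r IHr]; first by rewrite mul0r; apply: inV_0.
by rewrite -natr1 mulrDl mul1r; apply: inV_add.
Qed.

Lemma inV_pact Q y : inV y -> inV (pact gamma Q y).
Proof.
move=> Vy; elim/poly_ind: Q => [|Q a IHQ]; first by rewrite pact0; apply: inV_0.
rewrite pactDp pactC pactMX pact_comm //; apply: inV_add; last exact: inV_scale.
have [u [m [Uu Mm ->]]] := IHQ; exists (gamma u), (gamma m); split.
- exact: units1_gal.
- have -> : gamma m = pact gamma 'X m by rewrite -['X]expr1 pactXn expg1.
  exact: inM_pact.
- by rewrite rmorphD rmorphM rmorph_nat /= log_gal // T_gal.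
Qed.

(** The quotients of (1 + p a)^(p^m) - 1 by p^(m+1) start at a and change by a multiple of p^(m+1)
    at each step, so their limit is a modulo p. *)
Lemma cvg_ell_1p (a : Zp) : exists b,
  padic_cvg (ell^~ (1 + p%:R * iota a)) (p%:R * iota (a + p%:R * b)).
Proof.
have /choice[k kP] (m : nat) : exists k : Zp,
    (1 + p%:R * a) ^+ (p ^ m) = 1 + p%:R ^+ m.+1 * k.
  by have [z] := expr_pX_lift p_pr p_odd 0 m (1 : Zp) a; rewrite expr1n expr1 => ->; exists z.
have pX0 j : p%:R ^+ j != 0 :> Zp by rewrite expf_neq0 // padic_p_neq0.
have k0 : k 0%N = a.
  by apply: (mulfI (pX0 1%N)); apply: (addrI 1); rewrite -kP !expr1.
have /choice[z zP] (m : nat) : exists z : Zp, k m.+1 = k m + p%:R ^+ m.+1 * z.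
  have [z ez] := exprD_lift p_pr p_odd m (1 : Zp) (k m); exists z.
  apply: (mulfI (pX0 m.+2)); apply: (addrI 1); rewrite -kP expnSr exprM kP ez.
  by rewrite !expr1n mul1r.
have kE m : k m = a + p%:R * \sum_(i < m) p%:R ^+ i * z i.
  elim: m => [|m IHm]; first by rewrite big_ord0 mulr0 addr0.
  by rewrite zP IHm big_ord_recr /= mulrDr exprS mulrA addrA.
have [b bP] := padic_series z; exists b; apply/padic_cvgP => N; exists N => m Nm.
have -> : ell m (1 + p%:R * iota a) = p%:R * iota (k m).
  rewrite /ell; have := congr1 iota (kP m).
  rewrite rmorphXn !rmorphD !rmorphM rmorphXn !rmorph1 !rmorph_nat /= => ->.
  by rewrite addrAC subrr add0r exprSr mulrA mulrA mulVf ?mul1r ?expf_neq0.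
have [y ->] := bP m; rewrite kE -mulrBr -rmorphB.
have -> : a + p%:R * (\sum_(i < m) p%:R ^+ i * z i) -
  (a + p%:R * (\sum_(i < m) p%:R ^+ i * z i + p%:R ^+ m * y)) = p%:R ^+ m * (- (p%:R * y)) by ring.
rewrite rmorphM rmorphXn rmorph_nat /=; apply: OpowMl; first exact: rpred_nat.
by apply: (OpowW Nm); rewrite Opow_p Oint_iota.
Qed.

Lemma inV_T_log u : units1 u -> inV (T (log u)).
Proof.
move=> Uu; exists u, 0; rewrite mulr0 addr0; split => //.
by exists 0, 0; rewrite pact0 rmorph0 mul0r addr0.
Qed.

Lemma inV_unit (a : Zp) y : a \is a GRing.unit -> inV (iota a * y) -> inV y.
Proof.
move=> ua /(inV_scale a^-1); rewrite mulrA -rmorphM mulVr //.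
by rewrite rmorph1 mul1r.
Qed.

Lemma zeta_neq1 i : (i <= n)%N -> zeta ^+ (p ^ i) - 1 != 0.
Proof.
by move=> i_n; rewrite subr_eq0 -(prim_order_dvd zeta_prim) dvdn_Pexp2l // -ltnNge ltnS.
Qed.

(** The cyclotomic polynomial of order p^(n+1) is p at 1 and 0 at zeta: subtracting it from the
    constant 1 + p gives an f with f(1) = 1. *)
Lemma units1_1p : units1 (1 + p%:R).
Proof.
apply/units1P; exists (1 + p%:R - \sum_(j < p) 'X^(p ^ n) ^+ j).
  rewrite !hornerE horner_sum hornerMn hornerC.
  under eq_bigr do rewrite -exprM hornerXn expr1n.
  by rewrite sumr_const card_ord addrK.
rewrite rmorphB rmorphD rmorph1 rmorph_nat rmorph_sum /=.
suff -> : \sum_(j < p) peval zeta ('X^(p ^ n) ^+ j) = 0 by rewrite subr0.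
apply: (mulfI (zeta_neq1 (leqnn n))); rewrite mulr0.
under eq_bigr do rewrite !rmorphXn /= pevalX.
by rewrite -subrX1 -exprM -expnSr (prim_expr_order zeta_prim) subrr.
Qed.

Lemma T_iota1 (a : Zp) : T (iota a) = iota (a * (p%:R - 1)).
Proof. by rewrite -[iota a]mulr1 T_iota T1 // rmorphM rmorphB rmorph1 rmorph_nat. Qed.

(** T multiplies elements of Z_p by p - 1, so T log (1 + p) is p times a unit. *)
Lemma inV_p : inV p%:R.
Proof.
have [b bP] := cvg_ell_1p 1; move: bP; rewrite rmorph1 mulr1 => bP.
have := inV_T_log units1_1p.
rewrite (cvg_unique zeta_prim K_gen (cvg_log units1_1p) bP).
have -> : p%:R * iota (1 + p%:R * b) = iota (p%:R * (1 + p%:R * b)) by rewrite rmorphM rmorph_nat.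
have -> : T (iota (p%:R * (1 + p%:R * b))) = iota (-1 + p%:R * (1 + (p%:R - 1) * b)) * p%:R.
  by rewrite T_iota1 -[in RHS](rmorph_nat iota) -rmorphM; congr iota; ring.
by apply: inV_unit; rewrite padic_unitDp unitrN unitr1.
Qed.

Lemma gammaX : (gamma ^+ (p ^ n))%g = 1%g.
Proof.
rewrite -(sigmaX zeta_prim K_gen) ?ndvd_p1 //.
apply: (gal_inj K_gen).
rewrite (sigmaE zeta_prim K_gen) ?gal_id //; last by rewrite ndvdX // ndvd_p1.
apply/eqP; rewrite -[X in _ == X]expr1 (eq_prim_root_expr zeta_prim).
have := @modn_expX_lift p p_pr p_odd n p.+1 1; rewrite exp1n => -> //.
by rewrite -add1n modnDr.
Qed.

Lemma pact_comp P k x : pact gamma (P \Po 'X^k) x = pact (gamma ^+ k)%g P x.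
Proof.
elim/poly_ind: P x => [|P a IHP] x; first by rewrite comp_poly0 !pact0.
rewrite comp_polyD comp_polyM comp_polyX comp_polyC !pactDp !pactC pactMX.
by rewrite pactM // pactXn IHP.
Qed.

(* u = f(zeta) with f = 1 - p + Phi_p, so that f(1) = 1 and f(zeta_0) = 1 - p:
   the resulting P has invertible augmentation, hence is invertible modulo p
   because P^(p^n) = P(X^(p^n)) modulo p and gamma^(p^n) = 1. *)
Lemma inV_t : inV t.
Proof.
pose f : {poly Zp} := 1 - p%:R + \sum_(j < p) 'X^j.
have f1 : f.[1] = 1.
  rewrite /f !hornerE horner_sum hornerMn hornerC.
  under eq_bigr do rewrite hornerXn expr1n.
  by rewrite sumr_const card_ord subrK.
have [P [c [Pc [l [z [cvl Tl]]]]]] := T_log f1.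
have Uu : units1 (peval zeta f) by apply/units1P; exists f.
have fz0 : peval (zeta_ n zeta 0) f = 1 + p%:R * iota (-1).
  rewrite /f rmorphD rmorphB rmorph1 rmorph_nat rmorphN rmorph1 mulrN1 rmorph_sum /=.
  suff -> : \sum_(j < p) peval (zeta_ n zeta 0) 'X^j = 0 by rewrite addr0.
  apply: (mulfI (zeta_neq1 (leqnn n))); rewrite mulr0.
  under eq_bigr do rewrite rmorphXn /= pevalX /zeta_ subn0.
  by rewrite -subrX1 -exprM -expnSr (prim_expr_order zeta_prim) subrr.
have [b bP] := cvg_ell_1p (-1); rewrite fz0 in cvl.
(* log (1 - p) is -p modulo p^2 and T multiplies it by p - 1; comparison with the formula of [T_log]
   gives P(1) = -1 modulo p. *)
have uP1 : P.[1] \is a GRing.unit.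
  have pE (x : Zp) : p%:R * iota x = iota (p%:R * x) by rewrite rmorphM rmorph_nat.
  move: Tl; rewrite (cvg_unique zeta_prim K_gen cvl bP) !pE T_iota1 -rmorphN.
  move=> /Zp_to_ext_inj e.
  have -> : P.[1] = -1 + p%:R * (1 + b - p%:R * b - z).
    apply: (mulfI (padic_p_neq0 p_pr)); apply: (addIr (p%:R * (p%:R * z))).
    by rewrite -mulrDr -[LHS]opprK -e; ring.
  by rewrite padic_unitDp unitrN unitr1.
have VP : inV (pact gamma P t).
  have -> : pact gamma P t = T (log (peval zeta f)) + iota (- c) * p%:R.
    by rewrite Pc rmorphN mulNr addrK.
  by apply: inV_add (inV_T_log Uu) _; apply: inV_scale inV_p.
have VPk k : inV (pact gamma (P ^+ k.+1) t).
  by rewrite exprSr pactM //; apply: inV_pact.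
have [R PR] := frobenius_polyX p_odd P n.
have : inV (pact gamma (P \Po 'X^(p ^ n)) t).
  have -> : pact gamma (P \Po 'X^(p ^ n)) t =
      pact gamma (P ^+ (p ^ n)) t + p%:R * pact gamma (- R) t.
    rewrite PR pactDp -addrA -polyC_natr mul_polyC pactZ rmorph_nat /= -mulrDr -pactDp.
    by rewrite subrr pact0 mulr0 addr0.
  apply: inV_add; last by apply/inV_pM; exists (- R), 0; rewrite rmorph0 mul0r addr0.
  by rewrite -(prednK (_ : 0 < p ^ n)%N) ?expn_gt0 ?p_gt0.
rewrite pact_comp gammaX pact_fixed ?gal_id //.
exact: inV_unit.
Qed.

Lemma inM_V y : inM y -> inV y.
Proof.
move=> [P [c ->]]; apply: inV_add; first exact/inV_pact/inV_t.
exact/inV_scale/inV_p.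
Qed.

(** f(zeta)^(p^(n+1)) is f(zeta^D) = f(1) = 1 modulo p, and each further p-th power gains a factor
    p. *)
Lemma units1_pX f k : f.[1] = 1 -> exists r,
  peval zeta f ^+ (p ^ (n.+1 + k)) = 1 + p%:R ^+ k.+1 * peval zeta r.
Proof.
move=> f1; have [r er] := frobenius_polyX p_odd f n.+1.
have [w ew] := expr_pX_lift p_pr p_odd 0 k (f \Po 'X^D) r; exists w.
rewrite -rmorphXn expnD exprM er -[p%:R]expr1 ew rmorphD rmorphM !rmorphXn /= rmorph_nat.
by rewrite peval_comp (prim_expr_order zeta_prim) peval1 f1 rmorph1 expr1n.
Qed.

Lemma units1_addp u x : units1 u -> x \in Oint -> units1 (u + p%:R * x).
Proof.
move=> [y /OintP Oy <-] Ox; have [w /(Rz_Oint zeta_prim) Ow pw] := p_mul_pi zeta_prim.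
exists (y + w * x); last by rewrite pw mulrDr addrA mulrA.
by apply/OintP; rewrite rpredD ?rpredM.
Qed.

(* Successive approximation: y = sum_k p^k T (log u_k) = T (log u) where u is the
   infinite product of the u_k^(p^k). *)
Lemma inM_image y : inM y -> exists2 u, units1 u & T (log u) = y.
Proof.
move=> My; have /choice[F FP] (x : K) : exists um : K * K, inM x ->
    [/\ units1 um.1, inM um.2 & x = T (log um.1) + p%:R * um.2].
  case: (boolp.pselect (inM x)) => [/inM_V[u [m [Uu Mm xE]]]|nMx]; last by exists (0, 0).
  by exists (u, m).
pose m k := iter k (fun x => (F x).2) y; pose u k := (F (m k)).1.
have Mm k : inM (m k) by elim: k => //= k IHk; have [] := FP _ IHk.
have Uu k : units1 (u k) by have [] := FP _ (Mm k).
have mE k : m k = T (log (u k)) + p%:R * m k.+1 by have [] := FP _ (Mm k).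
pose w k := \prod_(i < k) u i ^+ (p ^ i).
have Uw k : units1 (w k).
  elim: k => [|k IHk]; first by rewrite /w big_ord0; apply: units1_1.
  by rewrite /w big_ord_recr; apply: units1M => //; apply: units1X.
have yE k : y = T (log (w k)) + p%:R ^+ k * m k.
  elim: k => [|k IHk]; first by rewrite /w big_ord0 log1 raddf0 add0r mul1r.
  rewrite {1}IHk {1}mE [w k.+1]big_ord_recr /= -/(w k) logM; [|exact: Uw|exact: units1X].
  by rewrite raddfD /= logX // natrX T_pX mulrDr addrA exprSr mulrA.
(* The factor u_i^(p^i) is known to be 1 modulo p only from i = n+1 on, hence the shift of the
   index. *)
have rec k : exists r, w (n.+1 + k).+1 = w (n.+1 + k)%N + p%:R ^+ k.+1 * peval zeta r.
  have /units1P[f f1 uf] := Uu (n.+1 + k)%N; have [r er] := units1_pX k f1.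
  have /units1P[g g1 wg] := Uw (n.+1 + k)%N; exists (g * r).
  by rewrite {1}/w big_ord_recr /= -/(w _) uf er rmorphM /= -wg; ring.
have [r rP] := choice rec; have [g gP] := poly_series K n r.
pose v := w n.+1 + p%:R * peval zeta g.
have Uv : units1 v by apply: units1_addp => //; apply/peval_Oint/(zeta_Oint zeta_prim).
have wv k : w (n.+1 + k)%N - v \in Opow k.+1.
  have wE : w (n.+1 + k)%N = w n.+1 + p%:R * \sum_(i < k) p%:R ^+ i * peval zeta (r i).
    elim: k => [|k IHk]; first by rewrite addn0 big_ord0 mulr0 addr0.
    by rewrite addnS rP IHk big_ord_recr /= mulrDr exprS mulrA addrA.
  have [s sP] := gP k; rewrite wE /v sP ?(prim_expr_order zeta_prim) //.
  have -> (a b c : K) : a + p%:R * b - (a + p%:R * (b + p%:R ^+ k * c)) = p%:R ^+ k.+1 * (- c).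
    by rewrite exprS; ring.
  by rewrite Opow_p rpredN peval_Oint ?(zeta_Oint zeta_prim).
(* One p^c clears the denominators of all of M, so the remainder p^(n+1+k) m tends to 0 although the
   m's change with k. *)
have [c cP] := inM_denominator.
exists v => //; apply/eqP; rewrite eq_sym -subr_eq0; apply/eqP.
apply: (Opow_sep zeta_prim K_gen) => N; pose k := (N + c)%N.
rewrite (yE (n.+1 + k)%N) addrAC -raddfB rpredD //.
  apply: T_Opow; apply: (@OpowW _ _ _ _ k.+1); first by rewrite /k; lia.
  exact: log_cong.
have -> : p%:R ^+ (n.+1 + k) = p%:R ^+ N * (p%:R ^+ n.+1 * p%:R ^+ c) :> K.
  by rewrite -!exprD; congr (_ ^+ _); rewrite /k; lia.
by rewrite -mulrA Opow_p -mulrA rpredM ?rpredX ?rpred_nat ?cP.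
Qed.

End Image.

Local Open Scope classical_set_scope.

Theorem theorem1p22 (p : nat) (p_pr : prime p) (p_odd : odd p) (n : nat)
    (K : splittingFieldType (padic_field p_pr)) (zeta : K)
    (zeta_prim : (p ^ n.+1).-primitive_root zeta)
    (K_gen : <<1; zeta>>%VS = {:K}%VS) :
  [set T_Delta n zeta (padic_log u) | u in units1 zeta] =
  [set x + y | x in cyclic_module n zeta (T_Delta n zeta (Ttilde n zeta))
             & y in cyclic_module n zeta p%:R].
Proof.
apply/seteqP; split=> y /=.
  move=> [u Uu <-]; have [P [c ->]] := inM_T_log p_odd zeta_prim K_gen Uu.
  exists (pact (gamma zeta) P (T_Delta n zeta (Ttilde n zeta))).
    by apply/(cyclic_moduleP p_odd zeta_prim K_gen); exists P.
  exists (Zp_to_ext K c * p%:R) => //.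
  by apply/(cyclic_module_p p_odd zeta_prim K_gen); exists c.
move=> [x /(cyclic_moduleP p_odd zeta_prim K_gen)[P ->]].
move=> [_ /(cyclic_module_p p_odd zeta_prim K_gen)[c ->] <-].
by apply: (inM_image p_odd zeta_prim K_gen); exists P, c.
Qed.
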